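(* For each $\alpha\in(\mathbb{C}\setminus\mathbb{Z})\cup r\mathbb{Z}$, the module $V_\alpha$ is ambidextrous. In particular, any simple module in $\mathcal{C}$ is ambidextrous.
   Context: Fix an integer $r\ge 2$ and set $q=e^{\pi\sqrt{-1}/r}$. For $z\in\mathbb{C}$ let $q^z=e^{\pi\sqrt{-1}z/r}$ and $\{z\}=q^z-q^{-z}$; set $\{0\}!=1$, $\{n\}!=\prod_{i=1}^n\{i\}$. $\overline{U}=\overline{U}^H_q(\mathfrak{sl}_2(\mathbb{C}))$ is the unital $\mathbb{C}$-algebra generated by $K^{\pm1},H,E,F$ with relations $KK^{-1}=K^{-1}K=1$, $HK=KH$, $HE-EH=2E$, $HF-FH=-2F$, $KE=q^2EK$, $KF=q^{-2}FK$, $EF-FE=\frac{K-K^{-1}}{q-q^{-1}}$, $E^r=F^r=0$; it is a Hopf algebra with $\Delta(E)=1\otimes E+E\otimes K$, $\Delta(F)=F\otimes 1+K^{-1}\otimes F$, $\Delta(K)=K\otimes K$, $\Delta(H)=H\otimes1+1\otimes H$, $\varepsilon(E)=\varepsilon(F)=\varepsilon(H)=0$, $\varepsilon(K)=1$, $S(E)=-EK^{-1}$, $S(F)=-KF$, $S(K)=K^{-1}$, $S(H)=-H$. A weight module is a finite dimensional module that is a direct sum of its $H$-eigenspaces and on which $K$ acts by $q^\lambda$ on the $H$-eigenspace of eigenvalue $\lambda$. $\mathcal{C}$ is the monoidal category of weight modules. $V_\alpha$ ($\alpha\in\mathbb{C}$) is the Verma module with basis $v_0,\dots,v_{r-1}$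 and action $Hv_i=(\alpha+r-1-2i)v_i$, $Ev_i=\frac{\{i\}\{i-\alpha\}}{\{1\}^2}v_{i-1}$, $Fv_i=v_{i+1}$ ($v_{-1}=v_r=0$). Duality: $V^\vee=\mathrm{Hom}_{\mathbb{C}}(V,\mathbb{C})$ with $(x\cdot f)(v)=f(S(x)v)$, and, with dual bases $\{v_i\},\{v_i^\vee\}$, $\mathrm{ev}_V(f\otimes v)=f(v)$, $\mathrm{coev}_V(1)=\sum_i v_i\otimes v_i^\vee$, $\widehat{\mathrm{ev}}_V(v\otimes f)=f(K^{1-r}v)$, $\widehat{\mathrm{coev}}_V(1)=\sum_i v_i^\vee\otimes K^{r-1}v_i$. Braiding: $c_{V,W}(v\otimes w)=\tau\big(q^{H\otimes H/2}\sum_{l=0}^{r-1}\frac{\{1\}^{2l}}{\{l\}!}q^{l(l-1)/2}E^lv\otimes F^lw\big)$, where $\tau$ is the swap and $q^{H\otimes H/2}$ acts by $q^{\lambda\mu/2}$ on tensors of vectors of weights $\lambda,\mu$. Partial traces: for $f\in\mathrm{End}(V\otimes W)$, $\mathrm{ptr}_R(f)=(\mathrm{id}_V\otimes\widehat{\mathrm{ev}}_W)(f\otimes\mathrm{id}_{W^\vee})(\mathrm{id}_V\otimes\mathrm{coev}_W)\in\mathrm{End}(V)$ and $\mathrm{ptr}_L(f)=(\mathrm{ev}_V\otimes\mathrm{id}_W)(\mathrm{id}_{V^\vee}\otimes f)(\widehat{\mathrm{coev}}_V\otimes\mathrm{id}_W)\in\mathrm{End}(W)$. Twist: $\theta_V=\mathrm{ptr}_R(c_{V,V})$.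 With these data $\mathcal{C}$ is a ribbon category. Reshetikhin--Turaev functor: $\mathbf{Rib}_{\mathcal{C}}$ is the category of $\mathcal{C}$-colored ribbon graphs (objects: finite sequences of pairs $(V,\pm)$; morphisms: isotopy classes of $\mathcal{C}$-colored ribbon graphs, in particular of framed oriented tangles with components colored by objects of $\mathcal{C}$; diagrams are read from bottom to top). $F:\mathbf{Rib}_{\mathcal{C}}\to\mathcal{C}$ is the unique ribbon functor with $F(V,+)=V$, $F(V,-)=V^\vee$; it sends an upward strand colored $V$ to $\mathrm{id}_V$, a crossing of upward strands in which the strand colored $V$ going from lower left to upper right passes over the strand colored $W$ to $c_{V,W}$ (the opposite crossing to the inverse braiding), positive twists to $\theta$, and oriented cups and caps to $\mathrm{coev},\widehat{\mathrm{coev}},\mathrm{ev},\widehat{\mathrm{ev}}$. A module $V\in\mathcal{C}$ is ambidextrous if $\mathrm{ptr}_L(F(T))=\mathrm{ptr}_R(F(T))$ in $\mathrm{End}_{\mathcal{C}}(V)$ for every $\mathcal{C}$-colored $(2,2)$-tangle $T$ whose open strands are colored by $V$ (an endomorphism of $((V,+),(V,+))$ in $\mathbf{Rib}_{\mathcal{C}}$). *)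

(* Defs.v *)
From HB Require Import structures.
From mathcomp Require Import all_boot all_order all_algebra.
From mathcomp Require Import boolp classical_sets reals sequences exp trigo.
From mathcomp Require Import complex mxtens.
From mathcomp Require Import ring lra.

Set Implicit Arguments.
Unset Strict Implicit.
Unset Printing Implicit Defensive.

Import Order.TTheory GRing.Theory Num.Theory.

Local Open Scope ring_scope.

Section QuantumNumbers.
Variables (R : realType) (r : nat).
Local Notation C := R[i].

Definition cexp (z : C) : C :=
  real_complex R (expR (complex.Re z)) * Complex (cos (complex.Im z)) (sin (complex.Im z)).

(* qpow z is q^z; for non-integral z it depends on the choice of logarithm
   pi * 'i / r of q. *)
Definition qpow (z : C) : C :=
  cexp (Complex 0 1 * real_complex R pi * z / r%:R).

Definition qroot : C := qpow 1.

Definition qbr (z : C) : C := qpow z - qpow (- z).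

Definition qfact (n : nat) : C := \prod_(1 <= i < n.+1) qbr i%:R.

Lemma cexpD (x y : C) : cexp (x + y) = cexp x * cexp y.
Proof.
case: x y => [a b] [c d]; rewrite /cexp /= expRD cosD sinD.
by apply/eqP; rewrite eq_complex /=; apply/andP; split; apply/eqP; ring.
Qed.

Lemma qpowD x y : qpow (x + y) = qpow x * qpow y.
Proof. by rewrite /qpow -cexpD -mulrDl -mulrDr. Qed.

Lemma qpow_real (x : R) :
  qpow (real_complex R x) = Complex (cos (pi * x / r%:R)) (sin (pi * x / r%:R)).
Proof.
rewrite /qpow -(rmorph_nat (real_complex R)) -fmorphV -!mulrA -!rmorphM /=.
have -> : Complex 0 1 * real_complex R (pi * (x / r%:R)) =
    Complex 0 (pi * (x / r%:R)).
  apply/eqP; rewrite eq_complex /=. by apply/andP; split; apply/eqP; ring.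
rewrite /cexp /= expR0.
apply/eqP; rewrite eq_complex /= !mul0r !mul1r. by apply/andP; split; apply/eqP; ring.
Qed.

Lemma qpow0 : qpow 0 = 1.
Proof.
by rewrite -(rmorph0 (real_complex R)) qpow_real mulr0 mul0r cos0 sin0.
Qed.

Lemma qpow_neq0 x : qpow x != 0.
Proof.
have : qpow 0 != 0 by rewrite qpow0 oner_neq0.
by rewrite -{1}(subrr x) qpowD mulf_eq0 negb_or => /andP[].
Qed.

Lemma qpowN x : qpow (- x) = (qpow x)^-1.
Proof.
by apply: (mulfI (qpow_neq0 x)); rewrite -qpowD subrr qpow0 divff ?qpow_neq0.
Qed.

Lemma qpow_r : (0 < r)%N -> qpow r%:R = -1.
Proof.
move=> r0; rewrite -(rmorph_nat (real_complex R)) qpow_real mulfK ?pnatr_eq0 -?lt0n//.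
by rewrite cospi sinpi; apply/eqP; rewrite eq_complex /= oppr0 !eqxx.
Qed.

Lemma qbr1_neq0 : (2 <= r)%N -> qbr 1 != 0.
Proof.
move=> r2; have r0 : 0 < r%:R :> R by rewrite ltr0n (leq_trans _ r2).
have s0 : 0 < sin (pi * 1 / r%:R : R).
  apply: sin_gt0_pi; rewrite mulr1 divr_gt0 ?pi_gt0//=.
  by rewrite ltr_pdivrMr// ltr_pMr ?pi_gt0// ltr1n.
rewrite /qbr -(rmorph1 (real_complex R)) -rmorphN !qpow_real.
rewrite mulrN mulNr cosN sinN eq_complex /= negb_and; apply/orP; right.
by rewrite opprK addr_eq0 gt_eqF// (lt_trans _ s0)// oppr_lt0.
Qed.

End QuantumNumbers.

(* Modules are given in coordinates: the carrier is C^n, written as column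
   vectors, and the generators act by left multiplication by matrices. *)
Section Modules.
Variable R : realType.
Local Notation C := R[i].

Record Umod := MkUmod {
  udim : nat;
  uH : 'M[C]_udim;
  uE : 'M[C]_udim;
  uF : 'M[C]_udim;
  uK : 'M[C]_udim;
  uKi : 'M[C]_udim (* action of K^-1 *)
}.

Record Uweight_module (r : nat) (V : Umod) : Prop := {
  urel_KKi : uK V * uKi V = 1;
  urel_KiK : uKi V * uK V = 1;
  urel_HK : uH V * uK V = uK V * uH V;
  urel_HE : uH V * uE V - uE V * uH V = uE V *+ 2;
  urel_HF : uH V * uF V - uF V * uH V = - (uF V *+ 2);
  urel_KE : uK V * uE V = qroot R r ^+ 2 *: (uE V * uK V);
  urel_KF : uK V * uF V = qroot R r ^- 2 *: (uF V * uK V);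
  urel_EF : uE V * uF V - uF V * uE V =
            (qroot R r - (qroot R r)^-1)^-1 *: (uK V - uKi V);
  urel_Er : uE V ^+ r = 0;
  urel_Fr : uF V ^+ r = 0;
  uwt_diag : diagonalizable (uH V);
  uwt_K : forall (l : C) (v : 'cV[C]_(udim V)),
            uH V *m v = l *: v -> uK V *m v = qpow r l *: v
}.

Record wmod (r : nat) := MkWmod {
  wmod_U :> Umod;
  wmodP : Uweight_module r wmod_U
}.

Definition simple_module (V : Umod) : Prop :=
  (0 < udim V)%N /\
  forall W : {vspace 'cV[C]_(udim V)},
    (forall v, v \in W ->
       [/\ uH V *m v \in W, uE V *m v \in W, uF V *m v \in W,
           uK V *m v \in W & uKi V *m v \in W]) ->
    W = 0%VS \/ W = fullv.

Definition uunit : Umod := @MkUmod 1 0 0 0 1%:M 1%:M.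

(* The tensor product is the Kronecker product: v_i (x) w_j is the basis vector
   of index mxtens_index (i, j), so that it is strictly associative up to the
   casts along mulnA. *)
Definition utens (V W : Umod) : Umod :=
  @MkUmod (udim V * udim W)
    (uH V *t 1%:M + 1%:M *t uH W)
    (1%:M *t uE W + uE V *t uK W)
    (uF V *t 1%:M + uKi V *t uF W)
    (uK V *t uK W)
    (uKi V *t uKi W).

(* In the dual basis, x acts by the transpose of the matrix of S(x). *)
Definition udual (V : Umod) : Umod :=
  @MkUmod (udim V)
    (- uH V)^T
    (- (uE V * uKi V))^T
    (- (uK V * uF V))^T
    (uKi V)^T
    (uK V)^T.

Record uhom (V W : Umod) := MkUhom {
  uhom_mx :> 'M[C]_(udim W, udim V);
  uhom_H : uhom_mx *m uH V = uH W *m uhom_mx;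
  uhom_E : uhom_mx *m uE V = uE W *m uhom_mx;
  uhom_F : uhom_mx *m uF V = uF W *m uhom_mx;
  uhom_K : uhom_mx *m uK V = uK W *m uhom_mx;
  uhom_Ki : uhom_mx *m uKi V = uKi W *m uhom_mx
}.

End Modules.

Section Ribbon.
Variables (R : realType) (r : nat).
Local Notation C := R[i].
Implicit Types V W : Umod R.

Definition ev V : 'M[C]_(1, udim V * udim V) :=
  \row_k let: (i, j) := mxtens_unindex k in (i == j)%:R.

Definition coev V : 'M[C]_(udim V * udim V, 1) :=
  \col_k let: (i, j) := mxtens_unindex k in (i == j)%:R.

(* v_i (x) v_j^* |-> v_j^*(K^(1-r) v_i) *)
Definition evh V : 'M[C]_(1, udim V * udim V) :=
  \row_k let: (i, j) := mxtens_unindex k in (uKi V ^+ r.-1) j i.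

(* 1 |-> \sum_i v_i^* (x) K^(r-1) v_i *)
Definition coevh V : 'M[C]_(udim V * udim V, 1) :=
  \col_k let: (i, j) := mxtens_unindex k in (uK V ^+ r.-1) j i.

Definition flip (m n : nat) : 'M[C]_(n * m, m * n) :=
  \matrix_(k, l) (((mxtens_unindex k).1 == (mxtens_unindex l).2) &&
                  ((mxtens_unindex k).2 == (mxtens_unindex l).1))%:R.

(* q^(H (x) H / 2): for weight modules exactly one matrix satisfies the
   condition (see qHHP and qHH_uniq below). *)
Definition is_qHH V W (D : 'M[C]_(udim V * udim W)) : Prop :=
  forall (l m : C) (v : 'cV[C]_(udim V)) (w : 'cV[C]_(udim W)),
    uH V *m v = l *: v -> uH W *m w = m *: w ->
    D *m (v *t w) = qpow r (l * m / 2%:R) *: (v *t w).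

Definition qHH V W : 'M[C]_(udim V * udim W) :=
  xget 0 [set D | is_qHH D]%classic.

Definition Rmx V W : 'M[C]_(udim V * udim W) :=
  qHH V W *m
  \sum_(l < r)
     (qbr r (1 : C) ^+ (2 * l) / qfact R r l *
      qpow r (l%:R * (l%:R - 1) / 2%:R)) *:
     ((uE V ^+ l) *t (uF W ^+ l)).

Definition braid V W : 'M[C]_(udim W * udim V, udim V * udim W) :=
  flip (udim V) (udim W) *m Rmx V W.

(* inverse of braid V W : the flips are mutually inverse, and Rmx V W is
   invertible for weight modules (an invertible diagonalizable matrix times a
   unipotent one) *)
Definition braidV V W : 'M[C]_(udim V * udim W, udim W * udim V) :=
  invmx (Rmx V W) *m flip (udim W) (udim V).

Definition ptrR V W (f : 'M[C]_(udim V * udim W)) : 'M[C]_(udim V) :=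
  castmx (muln1 _, muln1 _)
    (((1%:M : 'M_(udim V)) *t evh W)
     *m castmx (esym (mulnA _ _ _), esym (mulnA _ _ _))
          (f *t (1%:M : 'M_(udim W)))
     *m ((1%:M : 'M_(udim V)) *t coev W)).

Definition ptrL V W (f : 'M[C]_(udim V * udim W)) : 'M[C]_(udim W) :=
  castmx (mul1n _, mul1n _)
    ((ev V *t (1%:M : 'M_(udim W)))
     *m castmx (mulnA _ _ _, mulnA _ _ _)
          ((1%:M : 'M_(udim V)) *t f)
     *m (coevh V *t (1%:M : 'M_(udim W)))).

(* Objects of Rib_C: (V, true) is (V, +) and (V, false) is (V, -). *)
Definition colour := (wmod R r * bool)%type.

Definition Fcol (c : colour) : Umod R :=
  if c.2 then wmod_U c.1 else udual c.1.

Fixpoint Fobj (X : seq colour) : Umod R :=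
  match X with
  | [::] => uunit R
  | [:: c] => Fcol c
  | c :: X' => utens (Fcol c) (Fobj X')
  end.

Lemma udim_Fobj_cat X Y :
  (udim (Fobj X) * udim (Fobj Y) = udim (Fobj (X ++ Y)))%N.
Proof.
elim: X => [|c X IH]; first by rewrite mul1n.
case: X IH => [_|d X IH].
  by case: Y => [|e Y] //=; rewrite muln1.
by rewrite cat_cons /= -IH /= mulnA.
Qed.

(* Diagrams of C-coloured ribbon graphs, with the blackboard framing, read from
   bottom to top: X is the bottom, Y the top. A morphism of Rib_C is the isotopy
   class of such a diagram; since RT below is the value of the functor F, which
   depends only on the class, quantifying over Rib_C(X, Y) amounts to quantifying
   over [ribbon X Y].  Twists are curls, and crossings involving downward
   strands are obtained from the two below by means of cups and caps. *)
Inductive ribbon : seq colour -> seq colour -> Type :=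
| rb_id X : ribbon X X
| rb_comp X Y Z : ribbon Y Z -> ribbon X Y -> ribbon X Z
| rb_tens X Y X' Y' :
    ribbon X Y -> ribbon X' Y' -> ribbon (X ++ X') (Y ++ Y')
(* V goes from lower left to upper right, over W *)
| rb_over (V W : wmod R r) :
    ribbon [:: (V, true); (W, true)] [:: (W, true); (V, true)]
(* V goes from lower left to upper right, under W *)
| rb_under (V W : wmod R r) :
    ribbon [:: (V, true); (W, true)] [:: (W, true); (V, true)]
| rb_ev (V : wmod R r) : ribbon [:: (V, false); (V, true)] [::]
| rb_coev (V : wmod R r) : ribbon [::] [:: (V, true); (V, false)]
| rb_evh (V : wmod R r) : ribbon [:: (V, true); (V, false)] [::]
| rb_coevh (V : wmod R r) : ribbon [::] [:: (V, false); (V, true)]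
| rb_coupon X Y : uhom (Fobj X) (Fobj Y) -> ribbon X Y.

(* The Reshetikhin-Turaev functor. *)
Fixpoint RT X Y (T : ribbon X Y) : 'M[C]_(udim (Fobj Y), udim (Fobj X)) :=
  match T with
  | rb_id X => 1%:M
  | rb_comp X Y Z T2 T1 => RT T2 *m RT T1
  | rb_tens X Y X' Y' T1 T2 =>
      castmx (udim_Fobj_cat Y Y', udim_Fobj_cat X X') (RT T1 *t RT T2)
  | rb_over V W => braid V W
  | rb_under V W => braidV W V
  | rb_ev V => ev V
  | rb_coev V => coev V
  | rb_evh V => evh V
  | rb_coevh V => coevh V
  | rb_coupon X Y f => uhom_mx f
  end.

Definition ambidextrous (V : wmod R r) : Prop :=
  forall T : ribbon [:: (V, true); (V, true)] [:: (V, true); (V, true)],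
    ptrL (RT T : 'M_(udim V * udim V)) = ptrR (RT T : 'M_(udim V * udim V)).

End Ribbon.

Section QHH.
Variables (R : realType) (r : nat).
Local Notation C := R[i].

Lemma tensmx11 m n : (1%:M : 'M[C]_m) *t (1%:M : 'M[C]_n) = 1%:M.
Proof.
apply/matrixP => i j; case: (mxtens_indexP i) => a b.
case: (mxtens_indexP j) => c d; rewrite tensmxE !mxE -natrM mulnb.
by rewrite (can_eq (@mxtens_indexK m n)) xpair_eqE.
Qed.

Lemma weight_basis (V : wmod R r) :
  exists2 B : 'M[C]_(udim V), B \in unitmx &
    exists d : 'rV[C]_(udim V), uH V *m B = B *m diag_mx d.
Proof.
have [P Pu /diagonalizable_forPex[d /(simmxRL Pu) HE]] := uwt_diag (wmodP V).
exists (invmx P); first by rewrite unitmx_inv.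
by exists d; rewrite HE !mulmxA mulVmx// mul1mx.
Qed.

Lemma weight_coord n (A B : 'M[C]_n) (d : 'rV[C]_n) (l : C) (v : 'cV[C]_n) i :
  B \in unitmx -> A *m B = B *m diag_mx d -> A *m v = l *: v ->
  (invmx B *m v) i 0 = 0 \/ d 0 i = l.
Proof.
move=> Bu AB Av; set x := invmx B *m v.
have vE : v = B *m x by rewrite /x mulKVmx.
have dx : diag_mx d *m x = l *: x.
  have e : B *m (diag_mx d *m x) = B *m (l *: x).
    by rewrite mulmxA -AB -mulmxA -vE Av -scalemxAr -vE.
  by rewrite -[LHS](mulKmx Bu) e mulKmx.
move/matrixP/(_ i 0): dx; rewrite mul_diag_mx !mxE => /eqP.
rewrite -subr_eq0 -mulrBl mulf_eq0 subr_eq0 => /orP[/eqP ?|/eqP ?]; by [right|left].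
Qed.

Lemma qHHP (V W : wmod R r) : is_qHH r (qHH r V W).
Proof.
rewrite /qHH; apply: xgetPex.
have [B Bu [d Bd]] := weight_basis V; have [B' Bu' [d' Bd']] := weight_basis W.
pose D : 'rV[C]_(udim V * udim W) := \row_k
  qpow r (d 0 (mxtens_unindex k).1 * d' 0 (mxtens_unindex k).2 / 2%:R).
exists ((B *t B') *m diag_mx D *m (invmx B *t invmx B')) => l m v w Hv Hw.
rewrite -!mulmxA tensmx_mul.
have -> : diag_mx D *m (invmx B *m v *t (invmx B' *m w)) =
  qpow r (l * m / 2%:R) *: (invmx B *m v *t (invmx B' *m w)).
  apply/matrixP => i j; rewrite mul_diag_mx !mxE -/(mulmx _ _).
  case: (mxtens_indexP i) => a b; case: (mxtens_indexP j) => c e.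
  rewrite !mxtens_indexK /= !(ord1 c) !(ord1 e) -!/(mulmx _ _).
  have /= := weight_coord a Bu Bd Hv; rewrite mxE => -[->|->].
    by rewrite mul0r !mulr0.
  have /= := weight_coord b Bu' Bd' Hw; rewrite mxE => -[->|->] //.
  by rewrite !mulr0.
by rewrite -scalemxAr tensmx_mul !mulKVmx.
Qed.

Lemma qHH_uniq (V W : wmod R r) (D : 'M[C]_(udim V * udim W)) :
  is_qHH r D -> D = qHH r V W.
Proof.
move=> HD; have HQ := @qHHP V W.
have [B Bu [d Bd]] := weight_basis V; have [B' Bu' [d' Bd']] := weight_basis W.
have eig n (A P : 'M[C]_n) e j : A *m P = P *m diag_mx e ->
    A *m col j P = e 0 j *: col j P.
  move=> AP; rewrite !colE mulmxA AP -!colE; apply/matrixP => a b.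
  by rewrite mxE mul_mx_diag !mxE mulrC.
have e : D *m (B *t B') = qHH r V W *m (B *t B').
  apply/matrixP => i k; case: (mxtens_indexP k) => a b.
  have E (M : 'M_(udim V * udim W)) : (M *m (B *t B')) i (mxtens_index (a, b)) =
      (M *m (col a B *t col b B')) i 0.
    rewrite !mxE; apply: eq_bigr => j _; case: (mxtens_indexP j) => c f.
    by rewrite !mxE !mxtens_indexK.
  by rewrite !E (HD _ _ _ _ (eig _ _ _ _ _ Bd) (eig _ _ _ _ _ Bd'))
             (HQ _ _ _ _ (eig _ _ _ _ _ Bd) (eig _ _ _ _ _ Bd')).
have BI : (B *t B') *m (invmx B *t invmx B') = 1%:M.
  by rewrite tensmx_mul !mulmxV// tensmx11.
by rewrite -[LHS]mulmx1 -BI mulmxA e -mulmxA BI mulmx1.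
Qed.

End QHH.

Section Verma.
Variables (R : realType) (r : nat).
Local Notation C := R[i].
Variable a : C.

Definition verma_wt (i : nat) : C := a + r%:R - 1 - 2%:R * i%:R.

(* E v_i = verma_coef i *: v_(i-1) *)
Definition verma_coef (i : nat) : C :=
  qbr r i%:R * qbr r (i%:R - a) / qbr r (1 : C) ^+ 2.

Definition verma_U : Umod R := @MkUmod R r
  (diag_mx (\row_i verma_wt i))
  (\matrix_(i, j) (if j == i.+1 :> nat then verma_coef j else 0))
  (\matrix_(i, j) (i == j.+1 :> nat)%:R)
  (diag_mx (\row_i qpow r (verma_wt i)))
  (diag_mx (\row_i qpow r (- verma_wt i))).

Lemma verma_coefS i : (2 <= r)%N ->
  verma_coef i.+1 - verma_coef i =
  (qroot R r - (qroot R r)^-1)^-1 *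
    (qpow r (verma_wt i) - qpow r (- verma_wt i)).
Proof.
move=> r2; have b0 := qbr1_neq0 R r2; have r0 : (0 < r)%N by case: r r2.
rewrite /qroot -qpowN -/(qbr r (1 : C)).
apply: (mulfI (mulf_neq0 b0 b0)).
rewrite mulrBr /verma_coef expr2 [_ * (_ / _)]mulrC [_ * (_ / _)]mulrC.
rewrite !divfK ?mulf_neq0// mulrA mulfK//.
have wE : qpow r (verma_wt i) =
    - (qpow r a / qpow r (1 : C) / qpow r i%:R / qpow r i%:R).
  have -> : verma_wt i = a + r%:R + - 1 + - i%:R + - i%:R.
    by rewrite /verma_wt; ring.
  by rewrite !qpowD !qpowN qpow_r// mulrN1 !mulNr.
rewrite [qpow r (- verma_wt i)]qpowN wE /qbr -natr1 !qpowN !qpowD !qpowN.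
have := qpow_neq0 r (i%:R : C); have := qpow_neq0 r a.
have := qpow_neq0 r (1 : C).
move: (qpow r (1 : C)) (qpow r a) (qpow r (i%:R : C)) => z y x z0 y0 x0.
by field; rewrite z0 y0 x0.
Qed.

Lemma verma_coef0 : verma_coef 0 = 0.
Proof. by rewrite /verma_coef /qbr oppr0 subrr !mul0r. Qed.

Lemma verma_coefr : (2 <= r)%N -> verma_coef r = 0.
Proof.
move=> r2; rewrite /verma_coef {1}/qbr qpowN qpow_r; last by case: r r2.
by rewrite invrN invr1 subrr !mul0r.
Qed.

Lemma verma_wtS i : verma_wt i.+1 = verma_wt i - 2%:R.
Proof. by rewrite /verma_wt -natr1; ring. Qed.

Lemma sum_ord_pick n (f : nat -> C) (m : nat) :
  \sum_(k < n) (if k == m :> nat then f k else 0) =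
  if (m < n)%N then f m else 0.
Proof.
case: ifP => mn.
  rewrite (bigD1 (Ordinal mn))//= eqxx big1 ?addr0// => k /negPf.
  by rewrite -val_eqE /= => ->.
by apply: big1 => k _; case: eqP => // km; rewrite -km ltn_ord in mn.
Qed.

Lemma verma_EX n (i j : 'I_r) :
  (j != i + n :> nat)%N -> (uE verma_U ^+ n) i j = 0.
Proof.
elim: n i j => [|n IH] i j ij.
  by move: ij; rewrite expr0 mxE addn0 eq_sym val_eqE => /negPf ->.
rewrite exprS mxE big1 // => k _; rewrite mxE.
case: eqP => [ki|_]; last by rewrite mul0r.
by rewrite IH ?mulr0// ki addSnnS.
Qed.

Lemma verma_FX n (i j : 'I_r) :
  (i != j + n :> nat)%N -> (uF verma_U ^+ n) i j = 0.
Proof.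
elim: n i j => [|n IH] i j ij.
  by move: ij; rewrite expr0 mxE addn0 val_eqE => /negPf ->.
rewrite exprSr mxE big1 // => k _; rewrite [X in _ * X]mxE.
case: eqP => [kj|_]; last by rewrite mulr0.
by rewrite IH ?mul0r// kj addSnnS.
Qed.

Lemma verma_weight_module : (2 <= r)%N -> Uweight_module r verma_U.
Proof.
move=> r2; have r0 : (0 < r)%N by case: r r2.
have q2 : qpow r (2%:R : C) = qroot R r ^+ 2.
  by rewrite expr2 /qroot -qpowD -mulr2n.
have mxU : forall A B : 'M[C]_r, A * B = A *m B by [].
split; rewrite /= ?mxU.
- rewrite mulmx_diag; apply/matrixP => i j; rewrite !mxE.
  by rewrite -qpowD subrr qpow0.
- rewrite mulmx_diag; apply/matrixP => i j; rewrite !mxE.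
  by rewrite -qpowD addNr qpow0.
- by rewrite !mulmx_diag; congr diag_mx; apply/rowP => i; rewrite !mxE mulrC.
- apply/matrixP => i j; rewrite mul_diag_mx mul_mx_diag mulr2n !mxE.
  case: eqP => [->|_]; last by rewrite mulr0 mul0r subrr addr0.
  by rewrite verma_wtS; ring.
- apply/matrixP => i j; rewrite mul_diag_mx mul_mx_diag mulr2n !mxE.
  case: eqP => [->|_]; last by rewrite mulr0 mul0r subrr addr0 oppr0.
  by rewrite verma_wtS; ring.
- apply/matrixP => i j; rewrite mul_diag_mx mul_mx_diag !mxE.
  case: eqP => [->|_]; last by rewrite !mulr0 mul0r mulr0.
  rewrite verma_wtS qpowD qpowN q2.
  have : qroot R r != 0 by exact: qpow_neq0.
  by move: (qroot R r) => q q0; field.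
- apply/matrixP => i j; rewrite mul_diag_mx mul_mx_diag !mxE.
  case: eqP => [->|_]; last by rewrite !mulr0 mul0r mulr0.
  rewrite verma_wtS qpowD qpowN q2.
  have : qroot R r != 0 by exact: qpow_neq0.
  by move: (qroot R r) => q q0; field.
- apply/matrixP => i j; rewrite !mxE.
  under eq_bigr => k _ do rewrite !mxE.
  under [X in _ - X]eq_bigr => k _ do rewrite !mxE.
  have -> : \sum_(k < r) (if k == i.+1 :> nat then verma_coef k else 0) *
      (k == j.+1 :> nat)%:R = (i == j)%:R * verma_coef i.+1.
    transitivity (\sum_(k < r) (if k == i.+1 :> nat then
        (i == j)%:R * verma_coef k else 0)).
      apply: eq_bigr => k _; case: eqP => [->|_]; last by rewrite mul0r.
      by rewrite eqSS val_eqE mulrC.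
    rewrite (sum_ord_pick _ (fun k => (i == j)%:R * verma_coef k)).
    case: ifP => // ir; have -> : i.+1 = r; last by rewrite verma_coefr ?mulr0.
    by apply/eqP; rewrite eqn_leq ltn_ord leqNgt ir.
  have -> : \sum_(k < r) (i == k.+1 :> nat)%:R *
      (if j == k.+1 :> nat then verma_coef j else 0) = (i == j)%:R * verma_coef i.
    case: (posnP i) => [i0|ip].
      by rewrite i0 verma_coef0 mulr0 big1// => k _; rewrite /= mul0r.
    transitivity (\sum_(k < r) (if k == i.-1 :> nat then
        (i == j)%:R * verma_coef i else 0)).
      apply: eq_bigr => k _; rewrite -(eqSS k) prednK// eq_sym.
      case: eqP => [e|_]; last by rewrite mul0r.
      rewrite mul1r e (eq_sym (val j)) val_eqE.
      by case: eqP => [->|_]; rewrite ?mul1r ?mul0r.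
    rewrite (sum_ord_pick _ (fun=> (i == j)%:R * verma_coef i)).
    by rewrite (leq_ltn_trans (leq_pred i)).
  rewrite -mulrBr verma_coefS//.
  case: eqP => [->|ne]; first by rewrite mul1r !mulr1n.
  by rewrite mul0r !mulr0n subrr mulr0.
- apply/matrixP => i j; rewrite verma_EX ?mxE// neq_ltn.
  by rewrite (leq_trans (ltn_ord j)) ?leq_addl.
- apply/matrixP => i j; rewrite verma_FX ?mxE// neq_ltn.
  by rewrite (leq_trans (ltn_ord i)) ?leq_addl.
- exists 1%:M; first exact: unitmx1.
  by rewrite /similar_to conj1mx diag_mx_is_diag.
- move=> l v /matrixP Hv; apply/matrixP => i j; have := Hv i j.
  rewrite !mul_diag_mx !mxE => /eqP; rewrite -subr_eq0 -mulrBl mulf_eq0 subr_eq0.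
  by case/orP => /eqP ->; rewrite ?mulr0.
Qed.

Definition verma (hr : (2 <= r)%N) : wmod R r :=
  MkWmod (verma_weight_module hr).

End Verma.

(* Main.v *)
Require Import Defs.
From mathcomp Require Import all_boot all_order all_algebra.
From mathcomp Require Import boolp reals sequences exp trigo.
From mathcomp Require Import complex mxtens.
From mathcomp Require Import ring.

Set Implicit Arguments.
Unset Strict Implicit.
Unset Printing Implicit Defensive.

Import Order.TTheory GRing.Theory Num.Theory.

Local Open Scope ring_scope.

(** Why simple modules, and the typical Verma modules (those with alpha in
    rZ or outside Z), are ambidextrous.

    Tangles evaluate to U-linear maps (Ulin_RT), so it is enough to show that
    ptrL f = ptrR f for every f commuting with the coproducts DE of E and DF of
    F on V (x) V.  The only lengthy case of Ulin_RT is the braiding: the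
    intertwining relations of the R-matrix reduce to sums over l < r that
    telescope, the last term being zero because E^r = F^r = 0.

    Each V in question has a basis v_0, ..., v_n with F v_j = v_(j+1) and
    E v_(j+1) a nonzero multiple of v_j (a string).  For such V:

    - The kernel of E is the line through v_0, so U-linear endomorphisms are
      scalars (string_schur).  Both partial traces of f are U-linear, and they
      can be read off on different vectors: ptrL f on v_n and ptrR f on v_0.
    - The vector v_0 (x) v_n generates V (x) V; more precisely
      v_j (x) v_n = DF^j (v_0 (x) v_n), and v_0 (x) v_j is proportional to
      DE^(n-j) (v_0 (x) v_n).  Hence both scalars are linear in the coordinates
      a_s of f (v_0 (x) v_n) along v_s (x) v_(n-s).  The q-binomial theorem
      gives the coefficients as sums over j, which the hockey-stick identity
      sum_gbin evaluates: on both sides the coefficient of a_s is the Gaussian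
      binomial (n+1 choose s+1) in q^2 times an explicit factor (left_trace,
      right_trace).
    - These coefficients agree (string_coef_agree).  If n + 1 = r, the Gaussian
      binomial vanishes for s < n because q^2 is a primitive r-th root of unity,
      and for s = n the two factors are equal.  If n + 1 < r, the relation
      E v_(n+1) = 0 forces the weights of V to be symmetric up to sign, and the
      two factors are equal for all s.

    The standard basis of a typical Verma module is a string because
    {i}{i - alpha} does not vanish for 0 < i < r (verma_string).  In a simple
    module, a highest weight vector generates a string under F
    (simple_string_basis): were some E v_(j+1) zero, the vectors from v_(j+1) on
    would span V, and F would be both surjective and nilpotent. *)

(** * Kronecker products *)

Lemma cast_mxtens1l n (e : n = (1 * n)%N) (i : 'I_n) :
  cast_ord e i = mxtens_index (ord0, i).
Proof. exact: val_inj. Qed.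

Lemma cast_mxtens1r n (e : n = (n * 1)%N) (i : 'I_n) :
  cast_ord e i = mxtens_index (i, ord0).
Proof. by apply: val_inj; rewrite /= muln1 addn0. Qed.

Lemma cast_mxtensA m n p (e : (m * (n * p) = m * n * p)%N) (i : 'I_m) (j : 'I_n) (k : 'I_p) :
  cast_ord e (mxtens_index (i, mxtens_index (j, k))) =
  mxtens_index (mxtens_index (i, j), k).
Proof. by apply: val_inj; rewrite /= mulnDl mulnA addnA. Qed.

Lemma cast_mxtensAV m n p (e : (m * n * p = m * (n * p))%N) (i : 'I_m) (j : 'I_n) (k : 'I_p) :
  cast_ord e (mxtens_index (mxtens_index (i, j), k)) =
  mxtens_index (i, mxtens_index (j, k)).
Proof. by apply: val_inj; rewrite /= mulnDl mulnA addnA. Qed.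

Section Kronecker.
Variable R : comPzRingType.

Lemma tensmxDl m n p q (A A' : 'M[R]_(m, n)) (B : 'M[R]_(p, q)) :
  (A + A') *t B = A *t B + A' *t B.
Proof. by apply/matrixP => i j; rewrite !mxE mulrDl. Qed.

Lemma tensmxDr m n p q (A : 'M[R]_(m, n)) (B B' : 'M[R]_(p, q)) :
  A *t (B + B') = A *t B + A *t B'.
Proof. by apply/matrixP => i j; rewrite !mxE mulrDr. Qed.

Lemma tensmxZl m n p q a (A : 'M[R]_(m, n)) (B : 'M[R]_(p, q)) :
  (a *: A) *t B = a *: (A *t B).
Proof. by apply/matrixP => i j; rewrite !mxE mulrA. Qed.

Lemma tensmxZr m n p q a (A : 'M[R]_(m, n)) (B : 'M[R]_(p, q)) :
  A *t (a *: B) = a *: (A *t B).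
Proof. by apply/matrixP => i j; rewrite !mxE mulrCA. Qed.

Lemma tensmxNr m n p q (A : 'M[R]_(m, n)) (B : 'M[R]_(p, q)) :
  A *t (- B) = - (A *t B).
Proof. by rewrite -scaleN1r tensmxZr scaleN1r. Qed.

Lemma tensmxNl m n p q (A : 'M[R]_(m, n)) (B : 'M[R]_(p, q)) :
  (- A) *t B = - (A *t B).
Proof. by rewrite -scaleN1r tensmxZl scaleN1r. Qed.

Lemma tensmxX m n (A : 'M[R]_m) (B : 'M[R]_n) k :
  (A *t B) ^+ k = (A ^+ k) *t (B ^+ k).
Proof.
elim: k => [|k IH]; last by rewrite !exprS IH -!mulmxE tensmx_mul.
apply/matrixP => i j; case: (mxtens_indexP i) => a b.
case: (mxtens_indexP j) => c d; rewrite !expr0 tensmxE !mxE -natrM mulnb.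
by rewrite (can_eq (@mxtens_indexK m n)) xpair_eqE.
Qed.

Lemma tensmxA m n p q s t (A : 'M[R]_(m, n)) (B : 'M[R]_(p, q)) (C : 'M[R]_(s, t))
    (e1 : (m * p * s = m * (p * s))%N) (e2 : (n * q * t = n * (q * t))%N) :
  castmx (e1, e2) ((A *t B) *t C) = A *t (B *t C).
Proof.
apply/matrixP => i j; rewrite castmxE.
case: (mxtens_indexP i) => a i'; case: (mxtens_indexP i') => b c.
case: (mxtens_indexP j) => a' j'; case: (mxtens_indexP j') => b' c'.
by rewrite !cast_mxtensA !tensmxE mulrA.
Qed.

Lemma tensmx1l m n (A : 'M[R]_(m, n)) (e1 : (1 * m = m)%N) (e2 : (1 * n = n)%N) :
  castmx (e1, e2) ((1%:M : 'M_1) *t A) = A.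
Proof.
by apply/matrixP => i j; rewrite castmxE !cast_mxtens1l tensmxE mxE mul1r.
Qed.

Lemma tensmx1r m n (A : 'M[R]_(m, n)) (e1 : (m * 1 = m)%N) (e2 : (n * 1 = n)%N) :
  castmx (e1, e2) (A *t (1%:M : 'M_1)) = A.
Proof.
by apply/matrixP => i j; rewrite castmxE !cast_mxtens1r tensmxE mxE mulr1.
Qed.

(** The bilinear form with matrix M, as a covector on the tensor square.  The
    evaluations are such forms and the coevaluations their transposes, which
    turns linearity of the duality morphisms into matrix identities. *)
Definition mxform n (M : 'M[R]_n) : 'M[R]_(1, n * n) :=
  \row_k M (mxtens_unindex k).1 (mxtens_unindex k).2.

Lemma sum_mxtens m n (F : 'I_(m * n) -> R) :
  \sum_k F k = \sum_i \sum_j F (mxtens_index (i, j)).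
Proof.
rewrite pair_big /= (reindex (@mxtens_index m n)) /=.
  by apply: eq_bigr => -[i j].
by exists (@mxtens_unindex m n) => k _; rewrite ?mxtens_indexK ?mxtens_unindexK.
Qed.

Lemma mxformM n (M A B : 'M[R]_n) : mxform M *m (A *t B) = mxform (A^T *m M *m B).
Proof.
apply/rowP => k; case: (mxtens_indexP k) => i j.
rewrite !mxE sum_mxtens exchange_big; apply: eq_bigr => b _.
rewrite !mxtens_indexK !mxE mulr_suml; apply: eq_bigr => a _.
by rewrite !mxE !mxtens_indexK /= mulrA [M _ _ * _]mulrC.
Qed.

Lemma mxform_trM n (M A B : 'M[R]_n) :
  (A *t B) *m (mxform M)^T = (mxform (A *m M *m B^T))^T.
Proof.
apply: trmx_inj; rewrite trmx_mul !trmxK trmx_tens mxformM.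
by rewrite trmxK.
Qed.

Lemma mxform_trl n (M A B : 'M[R]_n) :
  mxform M^T *m (A *t B^T) = mxform (B *m M *m A)^T.
Proof. by rewrite mxformM -!trmx_mul mulmxA. Qed.

Lemma mxform_trr n (M A B : 'M[R]_n) :
  (A^T *t B) *m (mxform M^T)^T = (mxform (B *m M *m A)^T)^T.
Proof. by rewrite mxform_trM -!trmx_mul mulmxA. Qed.

Lemma mxformD n (M N : 'M[R]_n) : mxform (M + N) = mxform M + mxform N.
Proof. by apply/rowP => k; rewrite !mxE. Qed.

Lemma mxform_trD n (M N : 'M[R]_n) : (mxform M)^T + (mxform N)^T = (mxform (M + N))^T.
Proof. by apply/colP => k; rewrite !mxE. Qed.

Lemma mxform_trlD n (M N : 'M[R]_n) : mxform M^T + mxform N^T = mxform (M + N)^T.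
Proof. by apply/rowP => k; rewrite !mxE. Qed.

Lemma mxform_trrD n (M N : 'M[R]_n) :
  (mxform M^T)^T + (mxform N^T)^T = (mxform (M + N)^T)^T.
Proof. by apply/colP => k; rewrite !mxE. Qed.

Lemma mxform0 n : mxform (0 : 'M[R]_n) = 0.
Proof. by apply/rowP => k; rewrite !mxE. Qed.

End Kronecker.

(** * Morphisms of modules *)

Section Linear.
Variable R : realType.
Local Notation C := R[i].
Implicit Types V W : Umod R.

Definition Ulin V W (M : 'M[C]_(udim W, udim V)) : Prop :=
  [/\ M *m uE V = uE W *m M, M *m uF V = uF W *m M,
      M *m uK V = uK W *m M & M *m uKi V = uKi W *m M].

Lemma Ulin_id V : Ulin (1%:M : 'M_(udim V)).
Proof. by split; rewrite mulmx1 mul1mx. Qed.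

Lemma Ulin_comp U V W (N : 'M_(udim W, udim V)) (M : 'M_(udim V, udim U)) :
  Ulin N -> Ulin M -> Ulin (N *m M : 'M_(udim W, udim U)).
Proof.
move=> [nE nF nK nKi] [mE mF mK mKi].
split; rewrite -mulmxA.
- by rewrite mE !mulmxA nE.
- by rewrite mF !mulmxA nF.
- by rewrite mK !mulmxA nK.
- by rewrite mKi !mulmxA nKi.
Qed.

Lemma Ulin_tens V V' W W' (M : 'M_(udim W, udim V)) (N : 'M_(udim W', udim V')) :
  Ulin M -> Ulin N ->
  @Ulin (utens V V') (utens W W') (M *t N).
Proof.
move=> [mE mF mK mKi] [nE nF nK nKi].
split; rewrite /= ?mulmxDl ?mulmxDr !tensmx_mul ?mulmx1 ?mul1mx.
- by rewrite mE nE nK.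
- by rewrite mF nF mKi.
- by rewrite mK nK.
- by rewrite mKi nKi.
Qed.

Lemma Ulin_cast V1 V2 W1 W2 (eV : V1 = V2) (eW : W1 = W2) p q
    (M : 'M_(udim W1, udim V1)) :
  Ulin M -> @Ulin V2 W2 (castmx (p, q) M).
Proof. by case: V2 / eV q => q; case: W2 / eW p => p; rewrite castmx_id. Qed.

(** Associativity and the unit laws of utens are proved as equalities of
    modules, not as isomorphisms: linearity then passes through every castmx
    by Ulin_cast, whatever proofs of the dimension equalities it carries. *)
Lemma Umod_eq V W (e : udim V = udim W) :
  castmx (e, e) (uH V) = uH W -> castmx (e, e) (uE V) = uE W ->
  castmx (e, e) (uF V) = uF W -> castmx (e, e) (uK V) = uK W ->
  castmx (e, e) (uKi V) = uKi W -> V = W.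
Proof.
case: V W e => n H E F K Ki [n' H' E' F' K' Ki'] /= e.
by case: n' / e H' E' F' K' Ki' => H' E' F' K' Ki'; rewrite !castmx_id => -> -> -> -> ->.
Qed.

Lemma castmxD (A : nmodType) m n m' n' (e : (m = m') * (n = n')) (M N : 'M[A]_(m, n)) :
  castmx e (M + N) = castmx e M + castmx e N.
Proof. by case: e => e1 e2; case: m' / e1; case: n' / e2. Qed.

Lemma utensA U V W : utens (utens U V) W = utens U (utens V W).
Proof.
have e : udim (utens (utens U V) W) = udim (utens U (utens V W)).
  by rewrite /= mulnA.
apply: (Umod_eq (e := e)); move: e => /= e.
all: rewrite ?(tensmxDl, tensmxDr) ?castmxD -?tensmx11 ?tensmxA.
all: by rewrite ?addrA.
Qed.

Lemma utens1l V : utens (uunit R) V = V.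
Proof.
have e : udim (utens (uunit R) V) = udim V by rewrite /= mul1n.
apply: (Umod_eq (e := e)); move: e => /= e.
all: by rewrite ?tens0mx ?add0r ?addr0 ?tensmx1l.
Qed.

Lemma utens1r V : utens V (uunit R) = V.
Proof.
have e : udim (utens V (uunit R)) = udim V by rewrite /= muln1.
apply: (Umod_eq (e := e)); move: e => /= e.
all: by rewrite ?tensmx0 ?add0r ?addr0 ?tensmx1r.
Qed.

Lemma Fobj_cat r (X Y : seq (colour R r)) : Fobj (X ++ Y) = utens (Fobj X) (Fobj Y).
Proof.
elim: X => [|c X IH]; first by rewrite utens1l.
case: X IH => [_|d X IH]; first by case: Y => [|e Y] //=; rewrite utens1r.
by rewrite cat_cons; rewrite [LHS]/= -/(Fobj (d :: X ++ Y)) -cat_cons IH utensA.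
Qed.

End Linear.

(** * Commutation relations *)

Section Commutators.
Variables (C : fieldType) (n : nat) (q : C) (E F K Ki : 'M[C]_n).
Hypotheses (q_neq0 : q != 0) (qbr_neq0 : q - q^-1 != 0).
Hypotheses (KKi : K * Ki = 1) (KiK : Ki * K = 1).
Hypotheses (KE1 : K * E = q ^+ 2 *: (E * K)) (KF1 : K * F = q ^- 2 *: (F * K)).
Hypothesis EF1 : E * F - F * E = (q - q^-1)^-1 *: (K - Ki).

Lemma sqmxZl a (A B : 'M[C]_n) : (a *: A) * B = a *: (A * B).
Proof. by rewrite -mulmxE scalemxAl. Qed.

Lemma sqmxZr a (A B : 'M[C]_n) : A * (a *: B) = a *: (A * B).
Proof. by rewrite -mulmxE scalemxAr. Qed.

Lemma KiE1 : Ki * E = q ^- 2 *: (E * Ki).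
Proof.
have := congr1 (fun X => Ki * X * Ki) KE1.
rewrite mulrA KiK mul1r sqmxZr sqmxZl -!mulrA KKi mulr1 => ->.
by rewrite scalerA mulVf ?scale1r// expf_neq0.
Qed.

Lemma KiF1 : Ki * F = q ^+ 2 *: (F * Ki).
Proof.
have := congr1 (fun X => Ki * X * Ki) KF1.
rewrite mulrA KiK mul1r sqmxZr sqmxZl -!mulrA KKi mulr1 => ->.
by rewrite scalerA divff ?scale1r// expf_neq0.
Qed.

Lemma qcommX (A X : 'M[C]_n) a l :
  A * X = a *: (X * A) -> A * X ^+ l = a ^+ l *: (X ^+ l * A).
Proof.
move=> h; elim: l => [|l IH]; first by rewrite !expr0 scale1r mul1r mulr1.
by rewrite [X ^+ _]exprS mulrA h sqmxZl -mulrA IH sqmxZr scalerA -mulrA -exprS.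
Qed.

Lemma Xqcomm (A X : 'M[C]_n) a l :
  A * X = a *: (X * A) -> A ^+ l * X = a ^+ l *: (X * A ^+ l).
Proof.
move=> h; elim: l => [|l IH]; first by rewrite !expr0 scale1r mul1r mulr1.
rewrite [A ^+ _]exprS -mulrA IH sqmxZr mulrA h sqmxZl scalerA -exprSr.
by rewrite -mulrA.
Qed.

Lemma KE_X l : K * E ^+ l = (q ^+ l) ^+ 2 *: (E ^+ l * K).
Proof. by rewrite exprAC; apply: qcommX. Qed.

Lemma KF_X l : K * F ^+ l = (q ^+ l) ^- 2 *: (F ^+ l * K).
Proof. by rewrite exprAC -exprVn; apply: qcommX. Qed.

Lemma KiF_X l : Ki * F ^+ l = (q ^+ l) ^+ 2 *: (F ^+ l * Ki).
Proof. by rewrite exprAC; apply: qcommX; exact: KiF1. Qed.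

(** For x = q, the coefficient [l + 1] / (q - q^-1) of [E, F^(l+1)] and of
    [E^(l+1), F]. *)
Definition comm_coef (x : C) l : C := (x ^+ l.+1 - x ^- l.+1) / (x - x^-1) ^+ 2.

(** The scalar identities behind the induction steps of EF_X and FE_X. *)
Lemma comm_coefS l :
  (q - q^-1)^-1 + comm_coef q l * ((q ^+ l) ^-1 * q ^- 2) = comm_coef q l.+1 * q ^- l.+1 /\
  (q - q^-1)^-1 + comm_coef q l * (q ^+ l * q ^+ 2) = comm_coef q l.+1 * q ^+ l.+1.
Proof.
have d1 : q * q - 1 != 0.
  apply: contraNneq qbr_neq0 => h.
  by rewrite -(mulfK q_neq0 (q - q^-1)) mulrBl mulVf// h mul0r.
have x0 : q ^+ l != 0 by rewrite expf_neq0.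
rewrite /comm_coef !exprS; move: (q ^+ l) x0 => x x0.
by split; field; rewrite ?x0 ?q_neq0 ?d1.
Qed.

Lemma comm_coef0 : comm_coef q 0 = (q - q^-1)^-1.
Proof. by rewrite /comm_coef expr1 expr2 invfM mulrA divff ?mul1r. Qed.

Lemma EF_X l : E * F ^+ l.+1 = F ^+ l.+1 * E +
  comm_coef q l *: (F ^+ l * ((q ^+ l)^-1 *: K - q ^+ l *: Ki)).
Proof.
have EF : E * F = F * E + (q - q^-1)^-1 *: (K - Ki) by rewrite -EF1 addrC subrK.
elim: l => [|l IH].
  by rewrite !expr1 !expr0 invr1 !scale1r mul1r EF comm_coef0.
rewrite exprSr mulrA IH mulrDl -mulrA EF mulrDr mulrA -exprSr -addrA; congr (_ + _).
rewrite sqmxZl -!mulrA !mulrBl !sqmxZl KF1 KiF1 !mulrBr !sqmxZr !scalerBr !scalerA.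
rewrite ![F ^+ l * (F * _)]mulrA -exprSr mulrBr scalerBr addrACA -opprD.
by rewrite -!scalerDl; have [-> ->] := comm_coefS l.
Qed.

Lemma FE_X l : E ^+ l.+1 * F = F * E ^+ l.+1 +
  comm_coef q l *: (E ^+ l * (q ^+ l *: K - (q ^+ l)^-1 *: Ki)).
Proof.
have EF : E * F = F * E + (q - q^-1)^-1 *: (K - Ki) by rewrite -EF1 addrC subrK.
elim: l => [|l IH].
  by rewrite !expr1 !expr0 invr1 !scale1r mul1r EF comm_coef0.
rewrite exprSr -mulrA EF mulrDr mulrA IH mulrDl -mulrA -exprSr -addrA; congr (_ + _).
rewrite sqmxZl sqmxZr -!mulrA !mulrBl !sqmxZl KE1 KiE1 !mulrBr !sqmxZr !scalerBr !scalerA.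
rewrite ![E ^+ l * (E * _)]mulrA -exprSr addrC addrACA -opprD.
by rewrite -!scalerDl; have [-> ->] := comm_coefS l.
Qed.

End Commutators.

(** * Linearity of the duality morphisms *)

Section Duality.
Variables (R : realType) (r : nat).
Local Notation C := R[i].
Local Notation q := (qroot R r).

Lemma evE (V : Umod R) : ev V = mxform 1%:M.
Proof. by apply/rowP => k; rewrite !mxE. Qed.

Lemma coevE (V : Umod R) : coev V = (mxform 1%:M)^T.
Proof. by apply/colP => k; rewrite !mxE. Qed.

Lemma evhE (V : Umod R) : evh r V = mxform (uKi V ^+ r.-1)^T.
Proof. by apply/rowP => k; rewrite !mxE. Qed.

Lemma coevhE (V : Umod R) : coevh r V = (mxform (uK V ^+ r.-1)^T)^T.
Proof. by apply/colP => k; rewrite !mxE. Qed.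

Lemma q_neq0 : q != 0. Proof. exact: qpow_neq0. Qed.

Lemma qpow_nat n : qpow r (n%:R : C) = q ^+ n.
Proof. by elim: n => [|n IH]; rewrite ?qpow0 // -natr1 qpowD IH exprSr. Qed.

Hypothesis r_gt0 : (0 < r)%N.

Lemma q_r : q ^+ r = -1. Proof. by rewrite -qpow_nat qpow_r. Qed.

Lemma q2_r : (q ^+ 2) ^+ r = 1. Proof. by rewrite exprAC q_r sqrrN expr1n. Qed.

Section Weight.
Variables (V : Umod R) (hV : Uweight_module r V).
Local Notation E := (uE V).
Local Notation F := (uF V).
Local Notation K := (uK V).
Local Notation Ki := (uKi V).

Lemma KKiX n : K ^+ n * Ki ^+ n = 1.
Proof.
elim: n => [|n IH]; first by rewrite !expr0 mulr1.
by rewrite exprSr exprS mulrA -(mulrA _ K) (urel_KKi hV) mulr1.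
Qed.

Lemma KiKX n : Ki ^+ n * K ^+ n = 1.
Proof.
elim: n => [|n IH]; first by rewrite !expr0 mulr1.
by rewrite exprSr exprS mulrA -(mulrA _ Ki) (urel_KiK hV) mulr1.
Qed.

Lemma comm_inv (A B B' : 'M[C]_(udim V)) :
  B * B' = 1 -> B' * B = 1 -> A * B = B * A -> A * B' = B' * A.
Proof.
by move=> h h' c; rewrite -[LHS]mul1r -h' -!mulrA (mulrA B) -c -mulrA h mulr1.
Qed.

Lemma comm_E_Kr : E * K ^+ r = K ^+ r * E.
Proof. by rewrite (Xqcomm r (urel_KE hV)) q2_r scale1r. Qed.

Lemma comm_F_Kr : F * K ^+ r = K ^+ r * F.
Proof. by rewrite (Xqcomm r (urel_KF hV)) exprVn q2_r invr1 scale1r. Qed.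

Lemma comm_E_Kir : E * Ki ^+ r = Ki ^+ r * E.
Proof. exact: comm_inv (KKiX r) (KiKX r) comm_E_Kr. Qed.

Lemma comm_F_Kir : F * Ki ^+ r = Ki ^+ r * F.
Proof. exact: comm_inv (KKiX r) (KiKX r) comm_F_Kr. Qed.

Lemma KiKr : Ki ^+ r.-1 * Ki = Ki ^+ r. Proof. by rewrite -exprSr prednK. Qed.
Lemma KKir : Ki * Ki ^+ r.-1 = Ki ^+ r. Proof. by rewrite -exprS prednK. Qed.
Lemma KKr : K ^+ r.-1 * K = K ^+ r. Proof. by rewrite -exprSr prednK. Qed.
Lemma KrK : K * K ^+ r.-1 = K ^+ r. Proof. by rewrite -exprS prednK. Qed.

Lemma Ulin_ev : @Ulin R (utens (udual V) V) (uunit R) (ev V).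
Proof.
have KKi := urel_KKi hV; have KiK := urel_KiK hV.
rewrite evE; split;
  rewrite /= ?mul0mx ?mul1mx ?mulmxDr !mxformM -?mxformD ?trmxK !mulmxE ?mulr1 ?mul1r.
- by rewrite trmx1 mul1r mulNr -mulrA KiK mulr1 subrr mxform0.
- by rewrite addNr mxform0.
- by rewrite KiK.
- by rewrite KKi.
Qed.

Lemma Ulin_coev : @Ulin R (uunit R) (utens V (udual V)) (coev V).
Proof.
have KKi := urel_KKi hV; have KiK := urel_KiK hV.
rewrite coevE; split;
  rewrite /= ?mulmx0 ?mulmx1 ?mulmxDl !mxform_trM ?mxform_trD ?trmxK
    !mulmxE ?mul1r ?mulr1.
- by rewrite addNr mxform0 trmx0.
- by rewrite trmx1 mulr1 mulrN mulrA KiK mul1r subrr mxform0 trmx0.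
- by rewrite KKi.
- by rewrite KiK.
Qed.

(** Conjugation by K is the square of the antipode and K^r is central, so
    K^(1-r) identifies V with its double dual just as K does. *)
Lemma Ulin_evh : @Ulin R (utens V (udual V)) (uunit R) (evh r V).
Proof.
have KKi := urel_KKi hV; have KiK := urel_KiK hV.
have T1 : (1%:M : 'M[C]_(udim V))^T = 1%:M := trmx1 _ _.
rewrite evhE; split; rewrite /= ?mul0mx ?mul1mx.
- rewrite mulmxDr !mxform_trl mxform_trlD !mulmxE mulr1.
  by rewrite mulNr -[E * Ki * _]mulrA !KKir comm_E_Kir addNr trmx0 mxform0.
- rewrite -[X in _ *t X + _]T1 mulmxDr !mxform_trl mxform_trlD !mulmxE mul1r.
  rewrite !mulNr -!mulrA KiKr comm_F_Kir -KKir !mulrA KKi mul1r subrr.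
  by rewrite trmx0 mxform0.
- by rewrite mxform_trl !mulmxE KKir -KiKr -mulrA KiK mulr1.
- by rewrite mxform_trl !mulmxE -mulrA KiKr -KKir mulrA KKi mul1r.
Qed.

Lemma Ulin_coevh : @Ulin R (uunit R) (utens (udual V) V) (coevh r V).
Proof.
have KKi := urel_KKi hV; have KiK := urel_KiK hV.
have T1 : (1%:M : 'M[C]_(udim V))^T = 1%:M := trmx1 _ _.
rewrite coevhE; split; rewrite /= ?mulmx0 ?mulmx1.
- rewrite -[X in X *t _ + _]T1 mulmxDl !mxform_trr mxform_trrD !mulmxE mulr1.
  by rewrite KrK mulrN mulrA -comm_E_Kr -KKr -!mulrA KKi mulr1 subrr trmx0 mxform0 trmx0.
- rewrite mulmxDl !mxform_trr mxform_trrD !mulmxE mul1r.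
  by rewrite mulrN mulrA -[F * _ * _]mulrA KKr comm_F_Kr addNr trmx0 mxform0 trmx0.
- by rewrite mxform_trr !mulmxE KrK -KKr -mulrA KKi mulr1.
- by rewrite mxform_trr !mulmxE -mulrA KKr -KrK mulrA KiK mul1r.
Qed.

End Weight.
End Duality.

(** * Quantum integers *)

Section QuantumIntegers.
Variables (R : realType) (r : nat).
Local Notation C := R[i].
Local Notation q := (qroot R r).

Lemma sin_eq0_int (t : R) : sin t = 0 -> exists m : int, t = m%:~R * pi.
Proof.
wlog t0 : t / 0 <= t => [W st|st].
  have [t0|t0] := leP 0 t; first exact: W.
  have [||m mE] := W (- t); first by rewrite oppr_ge0 ltW.
    by rewrite sinN st oppr0.
  by exists (- m); rewrite rmorphN mulNr -mE opprK.
have p0 := pi_gt0 R; have /truncn_itv/andP[] : 0 <= t / pi by rewrite divr_ge0// ltW.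
set m := Num.trunc _; rewrite ler_pdivlMr// ltr_pdivrMr// => mt tm.
exists m; apply/eqP; rewrite -subr_eq0; apply/negPn/negP => sn.
have : 0 < sin (t - m%:R * pi).
  apply: sin_gt0_pi; rewrite lt_def sn subr_ge0 mt /=.
  by rewrite ltrBlDr -[X in X + _]mul1r -mulrDl nat1r.
suff -> : sin (t - m%:R * pi) = 0 by rewrite ltxx.
have := alternatingn (@sinDpi R) m (t - m%:R * pi).
rewrite -[pi *+ m]mulr_natl subrK st => /esym/eqP; rewrite mulf_eq0 signr_eq0 /=.
by move/eqP.
Qed.

Lemma qpow_complex (a b : R) :
  qpow r (Complex a b) = real_complex R (expR (- (pi * b / r%:R))) *
    Complex (cos (pi * a / r%:R)) (sin (pi * a / r%:R)).
Proof.
rewrite /qpow; have -> : Complex 0 1 * real_complex R pi * Complex a b / r%:R =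
    Complex (- (pi * b / r%:R)) (pi * a / r%:R).
  rewrite -(rmorph_nat (real_complex R)) -fmorphV.
  by apply/eqP; rewrite eq_complex /=; apply/andP; split; apply/eqP; ring.
by [].
Qed.

(** If q^z = q^(-z), comparing moduli shows that z is real; then
    {z} = 2i sin (pi z / r). *)
Lemma qbr_eq0 (z : C) : (0 < r)%N -> qbr r z = 0 -> exists m : int, z = r%:R * m%:~R.
Proof.
case: z => a b r0; have rn0 : r%:R != 0 :> R by rewrite pnatr_eq0 -lt0n.
have Nz : - Complex a b = Complex (- a) (- b) by [].
rewrite /qbr Nz !qpow_complex !mulrN !mulNr cosN sinN opprK => /eqP.
rewrite eq_complex /= => /andP[]; set x := pi * a / _; set y := pi * b / _.
rewrite !mul0r subr0 !addr0 => /eqP cE /eqP sE.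
have sx : sin x = 0.
  have : sin x * (expR (- y) + expR y) = 0 by rewrite -sE; ring.
  by move/eqP; rewrite mulf_eq0 (gt_eqF (addr_gt0 (expR_gt0 _) (expR_gt0 _))) orbF => /eqP.
have cx : cos x != 0.
  by apply/eqP => cx; have := cos2Dsin2 x; rewrite cx sx expr0n addr0 => /eqP;
    rewrite eq_sym oner_eq0.
have y0 : y = 0.
  have : cos x * (expR (- y) - expR y) = 0 by rewrite -cE; ring.
  move/eqP; rewrite mulf_eq0 (negPf cx) /= subr_eq0 => /eqP/expR_inj/eqP.
  by rewrite -subr_eq0 -opprD oppr_eq0 -mulr2n mulrn_eq0 /= => /eqP.
have b0 : b = 0.
  move/eqP: y0; rewrite /y !mulf_eq0 invr_eq0 (negPf rn0) orbF.
  by rewrite (gt_eqF (pi_gt0 R)) => /eqP.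
have [m /eqP] := sin_eq0_int sx; rewrite /x mulrAC [_ * pi]mulrC.
rewrite -mulrA (inj_eq (mulfI (lt0r_neq0 (pi_gt0 R)))) => /eqP aE.
exists m; rewrite b0 -(rmorph_nat (real_complex R)) -(rmorph_int (real_complex R)).
rewrite -rmorphM /= -aE. by rewrite mulrA mulfV// mul1r.
Qed.

Lemma qbr_nat n : qbr r (n%:R : C) = q ^+ n - q ^- n.
Proof. by rewrite /qbr qpowN qpow_nat. Qed.

Lemma qbr1 : qbr r (1 : C) = q - q^-1.
Proof. by rewrite -[1]/(1%:R) qbr_nat expr1. Qed.

Lemma nat_lt_multiple n (m : int) :
  (0 < n < r)%N -> n%:R <> r%:R * m%:~R :> C.
Proof.
move=> /andP[n0 nr]; rewrite -[X in X * _](rmorph_nat intr) -[LHS](rmorph_nat intr).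
rewrite -rmorphM => /intr_inj nE.
have : (r%:Z %| n%:Z)%Z by apply/dvdzP; exists m; rewrite mulrC -!natz.
by rewrite dvdzE !absz_nat gtnNdvd.
Qed.

Lemma qbr_nat_neq0 n : (0 < n < r)%N -> qbr r (n%:R : C) != 0.
Proof.
move=> nr; apply/eqP => /qbr_eq0 h; have /andP[n0 /(ltn_trans n0)/h[m]] := nr.
exact: nat_lt_multiple.
Qed.

End QuantumIntegers.

(** * Coefficients of the R-matrix *)

Section Coefficients.
Variables (R : realType) (r : nat).
Hypothesis r_ge2 : (2 <= r)%N.
Local Notation C := R[i].
Local Notation q := (qroot R r).

Lemma qbr1q : q - q^-1 != 0.
Proof. by have := qbr1_neq0 R r_ge2; rewrite qbr1. Qed.

Definition theta_coef l : C :=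
  qbr r (1 : C) ^+ (2 * l) / qfact R r l * qpow r (l%:R * (l%:R - 1) / 2%:R).

Lemma qfact_neq0 l : (l < r)%N -> qfact R r l != 0.
Proof.
move=> lr; rewrite /qfact big_nat_cond prodf_seq_neq0; apply/allP => i _.
apply/implyP => /andP[/andP[i0 il] _]; apply: qbr_nat_neq0.
by rewrite i0 (leq_trans il).
Qed.

(** The recursion that makes the commutators of the quasi-R-matrix with E and F
    telescope. *)
Lemma theta_coefS l : (l.+1 < r)%N ->
  theta_coef l.+1 * comm_coef q l = theta_coef l * q ^+ l.
Proof.
move=> lr.
have -> : comm_coef q l = qbr r l.+1%:R / qbr r (1 : C) ^+ 2.
  by rewrite /comm_coef qbr_nat qbr1.
rewrite /theta_coef.
have -> : qfact R r l.+1 = qfact R r l * qbr r l.+1%:R by rewrite /qfact big_nat_recr.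
have -> : qpow r (l.+1%:R * (l.+1%:R - 1) / 2%:R : C) =
    qpow r (l%:R * (l%:R - 1) / 2%:R) * q ^+ l.
  by rewrite -qpow_nat -qpowD; congr qpow; rewrite -natr1; field.
rewrite mulnS exprD.
have h1 := qfact_neq0 (ltnW lr); have h2 : qbr r (l.+1%:R : C) != 0.
  exact: qbr_nat_neq0.
have h3 := qbr1_neq0 R r_ge2.
by field; rewrite h1 h2 h3.
Qed.

Lemma theta_coef0 : theta_coef 0 = 1.
Proof. by rewrite /theta_coef /qfact big_nil muln0 expr0 !mul0r qpow0 divr1 mulr1. Qed.

End Coefficients.

Section WeightCommutators.
Variables (R : realType) (r : nat) (V : Umod R).
Hypotheses (r_ge2 : (2 <= r)%N) (hV : Uweight_module r V).
Local Notation C := R[i].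
Local Notation q := (qroot R r).
Local Notation E := (uE V).
Local Notation F := (uF V).
Local Notation K := (uK V).
Local Notation Ki := (uKi V).

Lemma uKE_X l : K * E ^+ l = (q ^+ l) ^+ 2 *: (E ^+ l * K).
Proof. exact: KE_X (urel_KE hV) l. Qed.

Lemma uKF_X l : K * F ^+ l = (q ^+ l) ^- 2 *: (F ^+ l * K).
Proof. exact: KF_X (urel_KF hV) l. Qed.

Lemma uKiF_X l : Ki * F ^+ l = (q ^+ l) ^+ 2 *: (F ^+ l * Ki).
Proof. exact: KiF_X (q_neq0 R r) (urel_KKi hV) (urel_KiK hV) (urel_KF hV) l. Qed.

Lemma uEF_X l : E * F ^+ l.+1 = F ^+ l.+1 * E +
  comm_coef q l *: (F ^+ l * ((q ^+ l)^-1 *: K - q ^+ l *: Ki)).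
Proof.
exact: EF_X (q_neq0 R r) (qbr1q R r_ge2) (urel_KKi hV) (urel_KiK hV) (urel_KF hV)
  (urel_EF hV) l.
Qed.

Lemma uFE_X l : E ^+ l.+1 * F = F * E ^+ l.+1 +
  comm_coef q l *: (E ^+ l * (q ^+ l *: K - (q ^+ l)^-1 *: Ki)).
Proof.
exact: FE_X (q_neq0 R r) (qbr1q R r_ge2) (urel_KKi hV) (urel_KiK hV) (urel_KE hV)
  (urel_EF hV) l.
Qed.

End WeightCommutators.

(** * Linearity of the braiding *)

Lemma eigen_col (F : fieldType) n (A P : 'M[F]_n) d j :
  A *m P = P *m diag_mx d -> A *m col j P = d 0 j *: col j P.
Proof.
move=> AP; rewrite !colE mulmxA AP -!colE; apply/matrixP => a b.
by rewrite mxE mul_mx_diag !mxE mulrC.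
Qed.

Lemma mul_tens_col (F : fieldType) p m n (M : 'M[F]_(p, m * n)) (P : 'M[F]_m) (Q : 'M[F]_n)
    i a b :
  (M *m (P *t Q)) i (mxtens_index (a, b)) = (M *m (col a P *t col b Q)) i 0.
Proof.
rewrite !mxE; apply: eq_bigr => j _; case: (mxtens_indexP j) => c f.
by rewrite !mxE !mxtens_indexK.
Qed.

Section Braiding.
Variables (R : realType) (r : nat) (V W : wmod R r).
Hypothesis r_ge2 : (2 <= r)%N.
Local Notation C := R[i].
Local Notation q := (qroot R r).
Local Notation n := (udim V).
Local Notation m := (udim W).
Local Notation D := (qHH r V W).

Let r_gt0 : (0 < r)%N. Proof. exact: ltnW. Qed.

Definition shifts (U : Umod R) (A : 'M[C]_(udim U)) (a : C) : Prop :=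
  forall (l : C) (v : 'cV_(udim U)), uH U *m v = l *: v ->
    uH U *m (A *m v) = (l + a) *: (A *m v).

Lemma shifts1 U : @shifts U 1%:M 0.
Proof. by move=> l v; rewrite mul1mx addr0. Qed.

Lemma shiftsE (U : wmod R r) : @shifts U (uE U) 2%:R.
Proof.
move=> l v Hv; have := urel_HE (wmodP U) => /eqP; rewrite subr_eq => /eqP h.
by rewrite mulmxA mulmxE h mulmxDl -mulmxA Hv mulr2n mulmxDl -scalemxAr addrC scalerDl
  scaler_nat mulr2n.
Qed.

Lemma shiftsF (U : wmod R r) : @shifts U (uF U) (- 2%:R).
Proof.
move=> l v Hv; have := urel_HF (wmodP U) => /eqP; rewrite subr_eq => /eqP h.
by rewrite mulmxA mulmxE h mulmxDl -mulmxA Hv mulNmx mulr2n mulmxDl -scalemxAr addrC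
  scalerDl scaleNr scaler_nat mulr2n.
Qed.

Lemma wtK (U : wmod R r) l (v : 'cV_(udim U)) :
  uH U *m v = l *: v -> uK U *m v = qpow r l *: v.
Proof. exact: uwt_K (wmodP U) _ _. Qed.

Lemma wtKi (U : wmod R r) l (v : 'cV_(udim U)) :
  uH U *m v = l *: v -> uKi U *m v = qpow r (- l) *: v.
Proof.
move=> /wtK h; have : uKi U *m (uK U *m v) = v.
  by rewrite mulmxA mulmxE (urel_KiK (wmodP U)) mul1mx.
rewrite h -scalemxAr => {2}<-.
by rewrite scalerA -qpowD addNr qpow0 scale1r.
Qed.

Lemma shiftsK (U : wmod R r) : @shifts U (uK U) 0.
Proof. by move=> l v Hv; rewrite (wtK Hv) -scalemxAr Hv addr0 !scalerA mulrC. Qed.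

Lemma shiftsKi (U : wmod R r) : @shifts U (uKi U) 0.
Proof. by move=> l v Hv; rewrite (wtKi Hv) -scalemxAr Hv addr0 !scalerA mulrC. Qed.

(** Weight vectors span both factors, so identities involving
    q^(H (x) H / 2) can be checked on its eigenvectors. *)
Lemma eq_on_weights p (M N : 'M[C]_(p, n * m)) :
  (forall l k (v : 'cV_n) (w : 'cV_m), uH V *m v = l *: v -> uH W *m w = k *: w ->
     M *m (v *t w) = N *m (v *t w)) -> M = N.
Proof.
move=> MN.
have [B Bu [d Bd]] := weight_basis V; have [B' Bu' [d' Bd']] := weight_basis W.
have e : M *m (B *t B') = N *m (B *t B').
  apply/matrixP => i k; case: (mxtens_indexP k) => a b.
  by rewrite !mul_tens_col (MN _ _ _ _ (eigen_col _ Bd) (eigen_col _ Bd')).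
have BI : (B *t B') *m (invmx B *t invmx B') = 1%:M.
  by rewrite tensmx_mul !mulmxV// tensmx11.
by rewrite -[LHS]mulmx1 -BI mulmxA e -mulmxA BI mulmx1.
Qed.

(** On vectors of weights l and k, moving q^(H (x) H / 2) past A (x) B changes
    its eigenvalue by q^((l b + k a + a b) / 2); A' and B' absorb this factor. *)
Lemma qHH_shift (A A' : 'M[C]_n) (B B' : 'M[C]_m) a b :
  @shifts V A a -> @shifts W B b ->
  (forall l k (v : 'cV_n) (w : 'cV_m), uH V *m v = l *: v -> uH W *m w = k *: w ->
     qpow r ((l + a) * (k + b) / 2%:R) *: ((A *m v) *t (B *m w)) =
     qpow r (l * k / 2%:R) *: ((A' *m v) *t (B' *m w))) ->
  D *m (A *t B) = (A' *t B') *m D.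
Proof.
move=> hA hB h; apply: eq_on_weights => l k v w Hv Hw.
rewrite -mulmxA tensmx_mul (@qHHP _ _ V W _ _ _ _ (hA _ _ Hv) (hB _ _ Hw)).
by rewrite -mulmxA (@qHHP _ _ V W _ _ _ _ Hv Hw) -scalemxAr tensmx_mul -h.
Qed.

Lemma qHH_EKi : D *m (uE V *t uKi W) = (uE V *t 1%:M) *m D.
Proof.
apply: qHH_shift (@shiftsE V) (@shiftsKi W) _ => l k v w Hv Hw.
rewrite mul1mx (wtKi Hw) tensmxZr scalerA -qpowD; congr (qpow _ _ *: _); by field.
Qed.

Lemma qHH_1E : D *m (1%:M *t uE W) = (uK V *t uE W) *m D.
Proof.
apply: qHH_shift (@shifts1 V) (@shiftsE W) _ => l k v w Hv Hw.
rewrite mul1mx (wtK Hv) tensmxZl scalerA -qpowD; congr (qpow _ _ *: _); by field.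
Qed.

Lemma qHH_F1 : D *m (uF V *t 1%:M) = (uF V *t uKi W) *m D.
Proof.
apply: qHH_shift (@shiftsF V) (@shifts1 W) _ => l k v w Hv Hw.
rewrite mul1mx (wtKi Hw) tensmxZr scalerA -qpowD; congr (qpow _ _ *: _); by field.
Qed.

Lemma qHH_KF : D *m (uK V *t uF W) = (1%:M *t uF W) *m D.
Proof.
apply: qHH_shift (@shiftsK V) (@shiftsF W) _ => l k v w Hv Hw.
rewrite mul1mx (wtK Hv) tensmxZl scalerA -qpowD; congr (qpow _ _ *: _); by field.
Qed.

Lemma qHH_KK : D *m (uK V *t uK W) = (uK V *t uK W) *m D.
Proof.
apply: qHH_shift (@shiftsK V) (@shiftsK W) _ => l k v w Hv Hw.
by rewrite !addr0.
Qed.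

Lemma qHH_unit : D \in unitmx.
Proof.
have [B Bu [d Bd]] := weight_basis V; have [B' Bu' [d' Bd']] := weight_basis W.
pose x : 'rV[C]_(n * m) :=
  \row_k qpow r (d 0 (mxtens_unindex k).1 * d' 0 (mxtens_unindex k).2 / 2%:R).
pose y : 'rV[C]_(n * m) := \row_k (x 0 k)^-1.
have DB : D *m (B *t B') = (B *t B') *m diag_mx x.
  apply/matrixP => i k; rewrite mul_mx_diag; case: (mxtens_indexP k) => a b.
  rewrite mul_tens_col (@qHHP _ _ V W _ _ _ _ (eigen_col _ Bd) (eigen_col _ Bd')).
  by case: (mxtens_indexP i) => c e; rewrite !mxE !mxtens_indexK /= mulrC.
have xy : diag_mx x *m diag_mx y = 1%:M.
  rewrite mulmx_diag; apply/matrixP => i j; rewrite !mxE divff ?mulr1n//.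
  exact: qpow_neq0.
have BI : (B *t B') *m (invmx B *t invmx B') = 1%:M.
  by rewrite tensmx_mul !mulmxV// tensmx11.
have [] // := @mulmx1_unit _ _ D (B *t B' *m diag_mx y *m (invmx B *t invmx B')).
by rewrite !mulmxA DB -(mulmxA (B *t B')) xy mulmx1.
Qed.

End Braiding.

Section Flip.
Variable R : realType.
Local Notation C := R[i].

Lemma flipE m n (a : 'I_n) (b c : 'I_m) (d : 'I_n) :
  flip R m n (mxtens_index (a, b)) (mxtens_index (c, d)) = ((a == d) && (b == c))%:R.
Proof. by rewrite mxE !mxtens_indexK. Qed.

Lemma flip_tens m n (A : 'M[C]_m) (B : 'M[C]_n) :
  flip R m n *m (A *t B) = (B *t A) *m flip R m n.
Proof.
apply/matrixP => i j; case: (mxtens_indexP i) => a b; case: (mxtens_indexP j) => c d.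
rewrite !mxE !sum_mxtens.
transitivity (A b c * B a d).
  rewrite (bigD1 b)//= (bigD1 a)//= flipE !eqxx mul1r tensmxE big1 ?addr0.
    rewrite big1 ?addr0// => k /negPf kb; apply: big1 => l _.
    by rewrite flipE [b == k]eq_sym kb andbF mul0r.
  by move=> k /negPf ka; rewrite flipE [a == k]eq_sym ka mul0r.
rewrite (bigD1 d)//= (bigD1 c)//= flipE !eqxx mulr1 tensmxE big1 ?addr0.
  rewrite big1 ?addr0 1?mulrC// => k /negPf kd; apply: big1 => l _.
  by rewrite flipE kd mulr0.
by move=> k /negPf kc; rewrite flipE kc andbF mulr0.
Qed.

Lemma flipK m n : flip R n m *m flip R m n = 1%:M.
Proof.
apply/matrixP => i j; case: (mxtens_indexP i) => a b; case: (mxtens_indexP j) => c d.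
rewrite !mxE sum_mxtens (bigD1 b)//= (bigD1 a)//= !flipE !eqxx mul1r big1 ?addr0.
  rewrite big1 ?addr0; last first.
    move=> k /negPf kb; apply: big1 => l _.
    by rewrite flipE [b == k]eq_sym kb andbF mul0r.
  by rewrite (can_eq (@mxtens_indexK m n)) xpair_eqE andbC.
by move=> k /negPf ka; rewrite flipE [a == k]eq_sym ka mul0r.
Qed.

Lemma Ulin_inv (V W : Umod R) (M : 'M_(udim W, udim V)) (N : 'M_(udim V, udim W)) :
  M *m N = 1%:M -> N *m M = 1%:M -> Ulin M -> Ulin N.
Proof.
move=> MN NM; have inv (x : 'M_(udim V)) (y : 'M_(udim W)) :
    M *m x = y *m M -> N *m y = x *m N.
  by move=> h; rewrite -[LHS]mulmx1 -MN mulmxA -(mulmxA N) -h mulmxA NM mul1mx.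
by case=> *; split; apply: inv.
Qed.

End Flip.

Section Rmatrix.
Variables (R : realType) (r : nat) (V W : wmod R r).
Hypothesis r_ge2 : (2 <= r)%N.
Local Notation C := R[i].
Local Notation q := (qroot R r).
Local Notation E := (uE V).
Local Notation F := (uF W).
Local Notation n := (udim V).
Local Notation m := (udim W).
Local Notation D := (qHH r V W).
Local Notation c := (theta_coef R r).

Let r_gt0 : (0 < r)%N. Proof. exact: ltnW. Qed.

(** The quasi-R-matrix: Rmx is qHH composed with theta. *)
Definition theta : 'M[C]_(n * m) := \sum_(l < r) c l *: ((E ^+ l) *t (F ^+ l)).

(** The intertwining relations of theta hold because their l-th terms are
    differences S (l + 1) - S l.  In both uses S r contains E^r or F^r. *)
Lemma theta_telescope (X Y : 'M[C]_(n * m)) (S : nat -> 'M[C]_(n * m)) :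
  S 0 = 0 -> S r = 0 ->
  (forall l, (l < r)%N -> c l *: (((E ^+ l) *t (F ^+ l)) *m X - Y *m ((E ^+ l) *t (F ^+ l))) =
     S l.+1 - S l) ->
  theta *m X = Y *m theta.
Proof.
move=> S0 Sr h; apply/eqP; rewrite -subr_eq0 mulmx_suml mulmx_sumr -sumrB.
have -> : \sum_(l < r) (c l *: (E ^+ l *t F ^+ l) *m X - Y *m (c l *: (E ^+ l *t F ^+ l))) =
    \sum_(l < r) (S l.+1 - S l).
  by apply: eq_bigr => l _; rewrite -h// scalerBr -scalemxAl -scalemxAr.
rewrite -(big_mkord xpredT (fun l => S l.+1 - S l)) telescope_sumr//.
by rewrite Sr S0 subr0.
Qed.

Lemma theta_E : theta *m (1%:M *t uE W + E *t uK W) = (1%:M *t uE W + E *t uKi W) *m theta.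
Proof.
pose S l := if l is k.+1 then
  c k *: ((E ^+ k.+1) *t (F ^+ k * (uK W - (q ^+ k) ^+ 2 *: uKi W))) else 0.
apply: (@theta_telescope _ _ S) => //.
  have S_gt0 l : (0 < l)%N -> S l =
    c l.-1 *: ((E ^+ l) *t (F ^+ l.-1 * (uK W - (q ^+ l.-1) ^+ 2 *: uKi W))) by case: l.
  by rewrite S_gt0// (urel_Er (wmodP V)) tens0mx scaler0.
move=> l lr.
have -> : S l.+1 = c l *: (E ^+ l.+1 *t (F ^+ l * uK W - uKi W * F ^+ l)).
  by rewrite /S (uKiF_X (wmodP W)) mulrBr sqmxZr.
have -> : S l = c l *: (E ^+ l *t (uE W * F ^+ l - F ^+ l * uE W)).
  case: l lr => [|k] kr; first by rewrite expr0 mulr1 mul1r subrr tensmx0 scaler0.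
  rewrite (uEF_X r_ge2 (wmodP W)) addrC addKr tensmxZr scalerA (theta_coefS R r_ge2 kr).
  rewrite /S -scalerA; congr (_ *: _); rewrite -tensmxZr; congr (_ *t _).
  rewrite -sqmxZr scalerBr !scalerA -expr2 divff ?scale1r//.
  by rewrite expf_neq0 ?q_neq0.
rewrite -scalerBr; congr (_ *: _).
rewrite mulmxDr mulmxDl !tensmx_mul !mul1mx !mulmx1 !mulmxE -exprSr -exprS.
by rewrite !tensmxDr !tensmxNr !opprB !opprD addrACA [RHS]addrC.
Qed.

Lemma theta_F : theta *m (uF V *t 1%:M + uKi V *t F) = (uF V *t 1%:M + uK V *t F) *m theta.
Proof.
pose S l := if l is k.+1 then
  - (c k *: ((E ^+ k * ((q ^+ k) ^+ 2 *: uK V - uKi V)) *t (F ^+ k.+1))) else 0.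
apply: (@theta_telescope _ _ S) => //.
  have S_gt0 l : (0 < l)%N -> S l = - (c l.-1 *:
    ((E ^+ l.-1 * ((q ^+ l.-1) ^+ 2 *: uK V - uKi V)) *t (F ^+ l))) by case: l.
  by rewrite S_gt0// (urel_Fr (wmodP W)) tensmx0 scaler0 oppr0.
move=> l lr.
have -> : S l.+1 = - (c l *: ((uK V * E ^+ l - E ^+ l * uKi V) *t F ^+ l.+1)).
  by rewrite /S (uKE_X (wmodP V)) mulrBr sqmxZr.
have -> : S l = - (c l *: ((E ^+ l * uF V - uF V * E ^+ l) *t F ^+ l)).
  case: l lr => [|k] kr; first by rewrite expr0 mulr1 mul1r subrr tens0mx scaler0 oppr0.
  rewrite (uFE_X r_ge2 (wmodP V)) addrC addKr tensmxZl scalerA (theta_coefS R r_ge2 kr).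
  rewrite /S -scalerA; congr (- (_ *: _)); rewrite -tensmxZl; congr (_ *t _).
  rewrite -sqmxZr scalerBr !scalerA -expr2 divff ?scale1r//.
  by rewrite expf_neq0 ?q_neq0.
rewrite opprK [RHS]addrC -scalerBr; congr (_ *: _).
rewrite mulmxDr mulmxDl !tensmx_mul !mul1mx !mulmx1 !mulmxE -exprSr -exprS.
by rewrite !tensmxDl !tensmxNl !opprB !opprD addrACA.
Qed.

Lemma theta_K : theta *m (uK V *t uK W) = (uK V *t uK W) *m theta.
Proof.
rewrite mulmx_suml mulmx_sumr; apply: eq_bigr => l _.
rewrite -scalemxAl -scalemxAr !tensmx_mul !mulmxE (uKE_X (wmodP V)) (uKF_X (wmodP W)).
congr (_ *: _); rewrite tensmxZl tensmxZr scalerA divff ?scale1r//.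
by rewrite !expf_neq0// q_neq0.
Qed.

(** theta is 1 plus a multiple of the nilpotent E (x) F, with which it
    commutes. *)
Lemma theta_unit : theta \in unitmx.
Proof.
pose x : 'M[C]_(n * m) := E *t F.
pose y : 'M[C]_(n * m) := \sum_(l < r.-1) c l.+1 *: x ^+ l.
have xy : GRing.comm x y.
  rewrite /GRing.comm -!mulmxE mulmx_suml mulmx_sumr; apply: eq_bigr => l _.
  by rewrite -scalemxAl -scalemxAr !mulmxE -exprS -exprSr.
have thE : theta = 1 + x * y.
  rewrite /theta (eq_bigr (fun l : 'I_r => c l *: x ^+ l)); last first.
    by move=> l _; rewrite /x tensmxX.
  rewrite -(big_mkord xpredT (fun l => c l *: x ^+ l)) big_ltn// big_add1.
  rewrite expr0 theta_coef0 scale1r big_mkord; congr (_ + _).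
  rewrite -mulmxE mulmx_sumr; apply: eq_bigr => l _.
  by rewrite -scalemxAr mulmxE -exprS.
have xyr : (- (x * y)) ^+ r = 0.
  rewrite exprNn exprMn_comm// {1}/x tensmxX (urel_Er (wmodP V)) tens0mx.
  by rewrite mul0r mulr0.
have := subrX1 (- (x * y)) r; rewrite xyr sub0r => /esym/(congr1 -%R).
rewrite opprK -mulNr opprB opprK -thE => h.
by have [] := @mulmx1_unit _ _ theta _ h.
Qed.

Lemma Rmx_unit : Rmx r V W \in unitmx.
Proof. by rewrite unitmx_mul qHH_unit theta_unit. Qed.

Lemma Rmx_E : Rmx r V W *m (1%:M *t uE W + E *t uK W) =
  (uK V *t uE W + E *t 1%:M) *m Rmx r V W.
Proof.
rewrite -mulmxA theta_E mulmxA mulmxDr qHH_1E qHH_EKi -mulmxDl.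
by rewrite -mulmxA.
Qed.

Lemma Rmx_F : Rmx r V W *m (uF V *t 1%:M + uKi V *t F) =
  (uF V *t uKi W + 1%:M *t F) *m Rmx r V W.
Proof.
rewrite -mulmxA theta_F mulmxA mulmxDr qHH_F1 qHH_KF -mulmxDl.
by rewrite -mulmxA.
Qed.

Lemma Rmx_K : Rmx r V W *m (uK V *t uK W) = (uK V *t uK W) *m Rmx r V W.
Proof. by rewrite -mulmxA theta_K mulmxA qHH_KK -mulmxA. Qed.

Lemma Ulin_braid : @Ulin R (utens V W) (utens W V) (braid r V W).
Proof.
have br X Y Y' : Rmx r V W *m X = Y *m Rmx r V W ->
    flip R n m *m Y = Y' *m flip R n m -> braid r V W *m X = Y' *m braid r V W.
  by move=> h1 h2; rewrite /braid -mulmxA h1 mulmxA h2 -mulmxA.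
have hK := br _ _ _ Rmx_K (flip_tens _ _).
have tK (X Y : wmod R r) : (uK X *t uK Y) *m (uKi X *t uKi Y) = 1%:M.
  by rewrite tensmx_mul !mulmxE !(urel_KKi (wmodP _)) tensmx11.
have tKi (X Y : wmod R r) : (uKi X *t uKi Y) *m (uK X *t uK Y) = 1%:M.
  by rewrite tensmx_mul !mulmxE !(urel_KiK (wmodP _)) tensmx11.
split=> //=.
- by apply: br Rmx_E _; rewrite mulmxDr !flip_tens -mulmxDl addrC.
- by apply: br Rmx_F _; rewrite mulmxDr !flip_tens -mulmxDl addrC.
- rewrite -[LHS]mul1mx -(tKi W V) -mulmxA; congr (_ *m _).
  by rewrite mulmxA -hK -mulmxA tK mulmx1.
Qed.

Lemma Ulin_braidV : @Ulin R (utens W V) (utens V W) (braidV r V W).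
Proof.
apply: (@Ulin_inv R (utens V W) (utens W V) (braid r V W) (braidV r V W) _ _ Ulin_braid);
  rewrite /braid /braidV /=.
  by rewrite mulmxA mulmxK ?Rmx_unit// flipK.
by rewrite mulmxA -(mulmxA (invmx _)) flipK mulmx1 mulVmx// Rmx_unit.
Qed.

End Rmatrix.

(** * Linearity of the Reshetikhin-Turaev functor and of partial traces *)

Section Functor.
Variables (R : realType) (r : nat).
Hypothesis r_ge2 : (2 <= r)%N.
Local Notation C := R[i].

Let r_gt0 : (0 < r)%N. Proof. exact: ltnW. Qed.

Lemma Ulin_RT (X Y : seq (colour R r)) (T : ribbon X Y) :
  @Ulin R (Fobj X) (Fobj Y) (RT T).
Proof.
elim: T => {X Y}.
- by move=> X; exact: Ulin_id.
- by move=> X Y Z T2 h2 T1 h1; exact: Ulin_comp h2 h1.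
- move=> X Y X' Y' T1 h1 T2 h2; apply: Ulin_cast (Ulin_tens h1 h2).
    by rewrite Fobj_cat.
  by rewrite Fobj_cat.
- by move=> V W; exact: Ulin_braid.
- by move=> V W; exact: Ulin_braidV.
- by move=> V; exact: Ulin_ev (wmodP V).
- by move=> V; exact: Ulin_coev (wmodP V).
- by move=> V; exact: Ulin_evh (wmodP V).
- by move=> V; exact: Ulin_coevh (wmodP V).
- by move=> X Y [M H E F K Ki]; split.
Qed.

Lemma Ulin_ptrR (V W : wmod R r) (f : 'M[C]_(udim V * udim W)) :
  @Ulin R (utens V W) (utens V W) f -> @Ulin R V V (ptrR r f).
Proof.
move=> hf; apply: (@Ulin_cast R (utens V (uunit R)) V (utens V (uunit R)) V);
  rewrite ?utens1r//.
have h1 : @Ulin R (utens V (uunit R)) (utens V (utens W (udual W))) (1%:M *t coev W).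
  exact: Ulin_tens (Ulin_id V) (Ulin_coev (wmodP W)).
have h3 : @Ulin R (utens V (utens W (udual W))) (utens V (uunit R)) (1%:M *t evh r W).
  exact: Ulin_tens (Ulin_id V) (Ulin_evh r_gt0 (wmodP W)).
have h2 := Ulin_tens hf (Ulin_id (udual W)).
have eA := utensA V W (udual W).
have h2' := Ulin_cast eA eA (esym (mulnA _ _ _)) (esym (mulnA _ _ _)) h2.
exact: Ulin_comp (Ulin_comp h3 h2') h1.
Qed.

Lemma Ulin_ptrL (V W : wmod R r) (f : 'M[C]_(udim V * udim W)) :
  @Ulin R (utens V W) (utens V W) f -> @Ulin R W W (ptrL r f).
Proof.
move=> hf; apply: (@Ulin_cast R (utens (uunit R) W) W (utens (uunit R) W) W);
  rewrite ?utens1l//.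
have h1 : @Ulin R (utens (uunit R) W) (utens (utens (udual V) V) W) (coevh r V *t 1%:M).
  exact: Ulin_tens (Ulin_coevh r_gt0 (wmodP V)) (Ulin_id W).
have h3 : @Ulin R (utens (utens (udual V) V) W) (utens (uunit R) W) (ev V *t 1%:M).
  exact: Ulin_tens (Ulin_ev (wmodP V)) (Ulin_id W).
have h2 := Ulin_tens (Ulin_id (udual V)) hf.
have eA := esym (utensA (udual V) V W).
have h2' := Ulin_cast eA eA (mulnA _ _ _) (mulnA _ _ _) h2.
exact: Ulin_comp (Ulin_comp h3 h2') h1.
Qed.

End Functor.

(** * Partial traces in coordinates *)

Section PartialTraces.
Variables (R : realType) (r : nat).
Local Notation C := R[i].

Lemma sum_delta n (F : 'I_n -> C) a : \sum_i F i * (i == a)%:R = F a.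
Proof.
rewrite (bigD1 a)//= eqxx mulr1 big1 ?addr0// => i /negPf ->.
by rewrite mulr0.
Qed.

Lemma ptrRE (V W : Umod R) (f : 'M[C]_(udim V * udim W)) a b :
  ptrR r f a b = \sum_k \sum_l (uKi W ^+ r.-1) l k *
    f (mxtens_index (a, k)) (mxtens_index (b, l)).
Proof.
rewrite /ptrR castmxE !cast_mxtens1r -mulmxA.
pose eA := esym (mulnA (udim V) (udim W) (udim W)).
have inner c k l : (castmx (eA, eA)
    (f *t (1%:M : 'M[C]_(udim W))) *m ((1%:M : 'M[C]_(udim V)) *t coev W))
    (mxtens_index (c, mxtens_index (k, l))) (mxtens_index (b, ord0)) =
    f (mxtens_index (c, k)) (mxtens_index (b, l)).
  rewrite mxE sum_mxtens.
  rewrite -[RHS](sum_delta (fun b' => f (mxtens_index (c, k)) (mxtens_index (b', l)))).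
  apply: eq_bigr => b' _; rewrite sum_mxtens exchange_big /=.
  rewrite -[X in X * _](sum_delta (fun l' => f (mxtens_index (c, k)) (mxtens_index (b', l')))).
  rewrite mulr_suml.
  apply: eq_bigr => l' _.
  rewrite -(sum_delta (fun k' => f (mxtens_index (c, k)) (mxtens_index (b', k')) *
    (l' == l)%:R * (b' == b)%:R)).
  apply: eq_bigr => k' _; rewrite castmxE !esymK !cast_mxtensA !tensmxE !mxE !mxtens_indexK /=.
  by rewrite [l == l']eq_sym !mulrA; ring.
rewrite mxE sum_mxtens (bigD1 a)//= [X in _ + X]big1 ?addr0; last first.
  move=> c /negPf ca; rewrite sum_mxtens big1// => k _; rewrite big1// => l _.
  by rewrite !tensmxE mxE [a == c]eq_sym ca !mul0r.
rewrite sum_mxtens; apply: eq_bigr => k _; apply: eq_bigr => l _.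
by rewrite inner tensmxE !mxE !mxtens_indexK eqxx mul1r.
Qed.

Lemma ptrLE (V W : Umod R) (f : 'M[C]_(udim V * udim W)) a b :
  ptrL r f a b = \sum_k \sum_l (uK V ^+ r.-1) l k *
    f (mxtens_index (k, a)) (mxtens_index (l, b)).
Proof.
rewrite /ptrL castmxE !cast_mxtens1l.
have inner c k l : ((ev V *t (1%:M : 'M[C]_(udim W))) *m
    castmx (mulnA (udim V) (udim V) (udim W), mulnA (udim V) (udim V) (udim W))
    ((1%:M : 'M[C]_(udim V)) *t f))
    (mxtens_index (ord0, a)) (mxtens_index (mxtens_index (k, l), c)) =
    f (mxtens_index (k, a)) (mxtens_index (l, c)).
  rewrite mxE sum_mxtens sum_mxtens.
  rewrite -[RHS](sum_delta (fun k' => f (mxtens_index (k', a)) (mxtens_index (l, c)))).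
  apply: eq_bigr => k' _.
  rewrite -[X in X * _](sum_delta (fun l' => f (mxtens_index (l', a)) (mxtens_index (l, c)))).
  rewrite mulr_suml.
  apply: eq_bigr => l' _.
  rewrite -(sum_delta (fun a' => f (mxtens_index (l', a')) (mxtens_index (l, c)) *
    (l' == k')%:R * (k' == k)%:R)).
  apply: eq_bigr => a' _; rewrite castmxE !cast_mxtensAV !tensmxE !mxE !mxtens_indexK /=.
  by rewrite [a == a']eq_sym [k' == l']eq_sym; ring.
rewrite mxE sum_mxtens sum_mxtens.
apply: eq_bigr => k _; apply: eq_bigr => l _.
rewrite (bigD1 b)//= [X in _ + X]big1 ?addr0; last first.
  by move=> c /negPf cb; rewrite !tensmxE [X in _ * (_ * X)]mxE cb !mulr0.
by rewrite inner tensmxE !mxE !mxtens_indexK eqxx mulr1 mulrC.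
Qed.

(** Any resolution of the identity of the traced factor computes the partial
    trace; a basis of eigenvectors of K makes the factor K^(1-r) a scalar. *)
Lemma ptrR_pairing (V W : Umod R) (f : 'M[C]_(udim V * udim W)) N
    (v : 'I_N -> 'cV[C]_(udim W)) (u : 'I_N -> 'rV[C]_(udim W))
    (x : 'rV[C]_(udim V)) (y : 'cV[C]_(udim V)) :
  \sum_j v j *m u j = 1%:M ->
  x *m ptrR r f *m y =
  \sum_j (x *t (u j *m uKi W ^+ r.-1)) *m f *m (y *t v j) :> 'M_1.
Proof.
move=> vu; apply/matrixP => i0 j0; rewrite !(ord1 i0) !(ord1 j0) {i0 j0} summxE.
set G := uKi W ^+ r.-1.
transitivity (\sum_b \sum_a \sum_k \sum_l
  x 0 a * (\sum_j v j l 0 * (u j *m G) 0 k) *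
    f (mxtens_index (a, k)) (mxtens_index (b, l)) * y b 0).
  rewrite mxE; apply: eq_bigr => b _; rewrite mxE mulr_suml; apply: eq_bigr => a _.
  rewrite ptrRE mulr_sumr mulr_suml; apply: eq_bigr => k _.
  rewrite mulr_sumr mulr_suml; apply: eq_bigr => l _.
  have -> : \sum_j v j l 0 * (u j *m G) 0 k = G l k.
    have /(congr1 (fun M => (M *m G) l k)) := vu; rewrite mul1mx => <-.
    rewrite mulmx_suml summxE; apply: eq_bigr => j _.
    by rewrite -mulmxA [RHS]mxE big_ord1.
  by rewrite !mulrA.
transitivity (\sum_b \sum_a \sum_k \sum_l \sum_j
  x 0 a * (v j l 0 * (u j *m G) 0 k) *
    f (mxtens_index (a, k)) (mxtens_index (b, l)) * y b 0).
  apply: eq_bigr => b _; apply: eq_bigr => a _; apply: eq_bigr => k _; apply: eq_bigr => l _.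
  by rewrite mulr_sumr !mulr_suml.
transitivity (\sum_j \sum_b \sum_l \sum_a \sum_k
  x 0 a * (v j l 0 * (u j *m G) 0 k) *
    f (mxtens_index (a, k)) (mxtens_index (b, l)) * y b 0).
  rewrite [RHS]exchange_big; apply: eq_bigr => b _ /=.
  rewrite [RHS]exchange_big.
  transitivity (\sum_l \sum_a \sum_k \sum_j
     x 0 a * (v j l 0 * (u j *m G) 0 k) *
    f (mxtens_index (a, k)) (mxtens_index (b, l)) * y b 0).
    rewrite [RHS]exchange_big; apply: eq_bigr => a _ /=.
    by rewrite exchange_big.
  apply: eq_bigr => l _; rewrite [RHS]exchange_big; apply: eq_bigr => a _ /=.
  by rewrite exchange_big.
apply: eq_bigr => j _; move: (u j *m G) => g; rewrite mxE sum_mxtens.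
apply: eq_bigr => b _; apply: eq_bigr => l _.
rewrite !mxE mulr_suml sum_mxtens; apply: eq_bigr => a _; apply: eq_bigr => k _.
rewrite !mxE !mxtens_indexK.
rewrite [(mxtens_unindex _).1]ord1 [(mxtens_unindex _).2]ord1 /=.
ring.
Qed.

Lemma ptrL_pairing (V W : Umod R) (f : 'M[C]_(udim V * udim W)) N
    (v : 'I_N -> 'cV[C]_(udim V)) (u : 'I_N -> 'rV[C]_(udim V))
    (x : 'rV[C]_(udim W)) (y : 'cV[C]_(udim W)) :
  \sum_j v j *m u j = 1%:M ->
  x *m ptrL r f *m y =
  \sum_j (u j *t x) *m f *m ((uK V ^+ r.-1 *m v j) *t y) :> 'M_1.
Proof.
move=> vu; apply/matrixP => i0 j0; rewrite !(ord1 i0) !(ord1 j0) {i0 j0} summxE.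
set G := uK V ^+ r.-1.
transitivity (\sum_b \sum_a \sum_k \sum_l
  x 0 a * (\sum_j (G *m v j) l 0 * u j 0 k) *
    f (mxtens_index (k, a)) (mxtens_index (l, b)) * y b 0).
  rewrite mxE; apply: eq_bigr => b _; rewrite mxE mulr_suml; apply: eq_bigr => a _.
  rewrite ptrLE mulr_sumr mulr_suml; apply: eq_bigr => k _.
  rewrite mulr_sumr mulr_suml; apply: eq_bigr => l _.
  have -> : \sum_j (G *m v j) l 0 * u j 0 k = G l k.
    have /(congr1 (fun M => (G *m M) l k)) := vu; rewrite mulmx1 => <-.
    rewrite mulmx_sumr summxE; apply: eq_bigr => j _.
    by rewrite mulmxA [RHS]mxE big_ord1.
  by rewrite !mulrA.
transitivity (\sum_b \sum_a \sum_k \sum_l \sum_j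
  x 0 a * ((G *m v j) l 0 * u j 0 k) *
    f (mxtens_index (k, a)) (mxtens_index (l, b)) * y b 0).
  apply: eq_bigr => b _; apply: eq_bigr => a _; apply: eq_bigr => k _; apply: eq_bigr => l _.
  by rewrite mulr_sumr !mulr_suml.
transitivity (\sum_j \sum_l \sum_b \sum_k \sum_a
  x 0 a * ((G *m v j) l 0 * u j 0 k) *
    f (mxtens_index (k, a)) (mxtens_index (l, b)) * y b 0).
  transitivity (\sum_b \sum_j \sum_l \sum_k \sum_a
    x 0 a * ((G *m v j) l 0 * u j 0 k) *
    f (mxtens_index (k, a)) (mxtens_index (l, b)) * y b 0).
    apply: eq_bigr => b _; rewrite [RHS]exchange_big.
    transitivity (\sum_l \sum_k \sum_a \sum_j
      x 0 a * ((G *m v j) l 0 * u j 0 k) *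
    f (mxtens_index (k, a)) (mxtens_index (l, b)) * y b 0).
      rewrite exchange_big; under eq_bigr => k _ do rewrite exchange_big.
      by rewrite exchange_big.
    apply: eq_bigr => l _; rewrite [RHS]exchange_big; apply: eq_bigr => k _ /=.
    by rewrite exchange_big.
  rewrite exchange_big; apply: eq_bigr => j _ /=.
  by rewrite exchange_big.
apply: eq_bigr => j _; move: (G *m v j) => g; rewrite mxE sum_mxtens.
apply: eq_bigr => l _; apply: eq_bigr => b _.
rewrite mxE mulr_suml sum_mxtens; apply: eq_bigr => k _; apply: eq_bigr => a _.
rewrite !mxE !mxtens_indexK.
rewrite [(mxtens_unindex _).1]ord1 [(mxtens_unindex _).2]ord1 /=.
ring.
Qed.

End PartialTraces.

(** * Gaussian binomials *)

Section Gauss.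
Variables (C : fieldType) (Q : C).

(** Gaussian binomials, defined by the Pascal rule that makes the hockey-stick
    sum sum_gbin a one-step induction; it is also the rule obtained by
    multiplying (A + B)^j by A + B on the left when B A = Q A B. *)
Fixpoint gbin (n m : nat) : C :=
  match n, m with
  | _, 0 => 1
  | 0, _.+1 => 0
  | n'.+1, m'.+1 => gbin n' m + Q ^+ (n' - m') * gbin n' m'
  end.

Lemma gbin0 n : gbin n 0 = 1. Proof. by case: n. Qed.

Lemma gbinS n m : gbin n.+1 m.+1 = gbin n m.+1 + Q ^+ (n - m) * gbin n m.
Proof. by []. Qed.

Lemma gbin_small n m : (n < m)%N -> gbin n m = 0.
Proof.
elim: n m => [|n IH] [|m] //; rewrite ltnS => nm.
by rewrite gbinS !IH ?mulr0 ?addr0// ltnS ltnW.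
Qed.

Lemma sum_gbin n m : \sum_(j < n) Q ^+ j * gbin j m = Q ^+ m * gbin n m.+1.
Proof.
elim: n => [|n IH]; first by rewrite big_ord0 gbin_small ?mulr0.
rewrite big_ord_recr IH /= mulrDr mulrA -exprD; congr (_ + _).
case: (leqP m n) => [mn|nm]; first by rewrite subnKC.
by rewrite gbin_small ?mulr0.
Qed.

Lemma gbin_prod n m : (m <= n)%N ->
  gbin n m * \prod_(i < m) (1 - Q ^+ i.+1) * \prod_(i < n - m) (1 - Q ^+ i.+1) =
  \prod_(i < n) (1 - Q ^+ i.+1).
Proof.
elim: n m => [|n IH] [|m] //; first by rewrite !big_ord0 !mulr1.
  by rewrite gbin0 big_ord0 !mul1r subn0.
rewrite ltnS => mn; rewrite gbinS subSS !mulrDl [RHS]big_ord_recr /=.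
have h1 : gbin n m.+1 * \prod_(i < m.+1) (1 - Q ^+ i.+1) * \prod_(i < n - m) (1 - Q ^+ i.+1)
    = \prod_(i < n) (1 - Q ^+ i.+1) * (1 - Q ^+ (n - m)).
  move: mn; rewrite leq_eqVlt => /predU1P[->|mn].
    by rewrite gbin_small// subnn expr0 subrr !mul0r mulr0.
  by rewrite -(IH m.+1)// -(subnSK mn) [\prod_(i < (n - m.+1).+1) _]big_ord_recr /= !mulrA.
have -> : Q ^+ n.+1 = Q ^+ (n - m) * Q ^+ m.+1 by rewrite -exprD addnS subnK.
by rewrite h1 big_ord_recr /= -(IH m mn); ring.
Qed.

(** By gbin_prod: the product of the 1 - Q^i over 0 < i <= r is zero, those over
    0 < i <= m and 0 < i <= r - m are not. *)
Lemma gbin_root r m : Q ^+ r = 1 -> (forall i, (0 < i < r)%N -> Q ^+ i != 1) ->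
  (0 < m < r)%N -> gbin r m = 0.
Proof.
move=> Qr Qi /andP[m0 mr]; have := gbin_prod (ltnW mr).
have nz k : (k < r)%N -> \prod_(i < k) (1 - Q ^+ i.+1) != 0.
  move=> kr; apply/prodf_neq0 => i _; rewrite subr_eq0 eq_sym Qi//=.
  by rewrite (leq_ltn_trans (ltn_ord i)).
have r0 : (0 < r)%N by apply: leq_trans mr.
have -> : \prod_(i < r) (1 - Q ^+ i.+1) = 0.
  by case: r r0 Qr {mr Qi nz} => // r _ Qr; rewrite big_ord_recr /= Qr subrr mulr0.
move/eqP; rewrite !mulf_eq0 (negPf (nz _ mr)) orbF (negPf (nz (r - m)%N _)) ?orbF => [/eqP//|].
by rewrite -{2}(subn0 r) ltn_sub2l.
Qed.

Lemma gbin_expansion n (A B : 'M[C]_n) j :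
  B * A = Q *: (A * B) ->
  (A + B) ^+ j = \sum_(s < j.+1) gbin j s *: (A ^+ (j - s) * B ^+ s).
Proof.
move=> BA; elim: j => [|j IH].
  by rewrite big_ord_recl big_ord0 /= !expr0 mulr1 scale1r addr0.
rewrite exprS IH mulrDl [RHS]big_ord_recl /= expr0 mulr1 scale1r.
under [X in _ = _ + X]eq_bigr => i _ do rewrite /bump /= add1n subSS scalerDl.
rewrite big_split /= addrA; congr (_ + _).
  transitivity (\sum_(s < j.+2) gbin j s *: (A ^+ (j.+1 - s) * B ^+ s)).
    rewrite [RHS]big_ord_recr /= [X in X *: _]gbin_small// scale0r addr0.
    rewrite -mulmxE mulmx_sumr; apply: eq_bigr => s _.
    by rewrite -scalemxAr !mulmxE mulrA -exprS subSn// -ltnS.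
  by rewrite big_ord_recl /= gbin0 expr0 mulr1 scale1r.
rewrite -mulmxE mulmx_sumr; apply: eq_bigr => s _.
rewrite -scalemxAr !mulmxE mulrA (qcommX _ BA) sqmxZl scalerA mulrC -mulrA.
by rewrite -exprS.
Qed.

End Gauss.

Arguments gbin {C} Q n m : simpl never.

(** * Bases of strings *)

Section String.
Variables (C : fieldType) (N n : nat) (q kap : C) (E F K Ki : 'M[C]_N).
Variables (v : nat -> 'cV[C]_N) (u : nat -> 'rV[C]_N).

(** Indexing the string by all of nat, with v n.+1 = 0, lets F and E act without
    bounds on the index. *)
Record hw_string : Prop := HwString {
  hw_F : forall j, F *m v j = v j.+1;
  hw_end : v n.+1 = 0;
  hw_last : v n != 0;
  hw_E0 : E *m v 0 = 0;
  hw_K0 : K *m v 0 = kap *: v 0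
}.

Record string_basis : Prop := StringBasis {
  sb_E : forall j, (j < n)%N -> E *m v j.+1 != 0;
  sb_dual : forall i j, (i <= n)%N -> (j <= n)%N -> u i *m v j = (i == j)%:R%:M;
  sb_sum : \sum_(j < n.+1) v j *m u j = 1%:M
}.

Hypothesis hw : hw_string.
Hypotheses (q_neq0 : q != 0) (qbr_neq0 : q - q^-1 != 0).
Hypotheses (KKi : K * Ki = 1) (KiK : Ki * K = 1).
Hypotheses (KE1 : K * E = q ^+ 2 *: (E * K)) (KF1 : K * F = q ^- 2 *: (F * K)).
Hypothesis EF1 : E * F - F * E = (q - q^-1)^-1 *: (K - Ki).

(** Eigenvalue of K on v j. *)
Definition str_wt j : C := kap / (q ^+ j) ^+ 2.

(** Matrix coefficient of E from v j to v (j - 1). *)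
Definition str_coef j : C :=
  (q ^+ j - q ^- j) * (kap * q / q ^+ j - q ^+ j / (kap * q)) / (q - q^-1) ^+ 2.

Definition str_fact m : C := \prod_(t < m) str_coef t.+1.

Lemma string_FX j s : F ^+ s *m v j = v (s + j).
Proof.
elim: s => [|s IH]; first by rewrite expr0 mul1mx.
by rewrite exprS -mulmxE -mulmxA IH (hw_F hw).
Qed.

Lemma string_neq0 j : (j <= n)%N -> v j != 0.
Proof.
move=> jn; apply: contraNneq (hw_last hw) => v0.
by rewrite -(subnK jn) -string_FX v0 mulmx0.
Qed.

Lemma kap_neq0 : kap != 0.
Proof.
apply/eqP => k0; have : Ki *m (K *m v 0) = v 0 by rewrite mulmxA mulmxE KiK mul1mx.
rewrite (hw_K0 hw) k0 scale0r mulmx0 => /esym/eqP; apply/negP.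
exact: string_neq0.
Qed.

Lemma str_wt_neq0 j : str_wt j != 0.
Proof. by rewrite mulf_neq0 ?kap_neq0// invr_eq0 !expf_neq0. Qed.

Lemma string_K j : K *m v j = str_wt j *: v j.
Proof.
elim: j => [|j IH]; first by rewrite /str_wt expr0 expr1n divr1 (hw_K0 hw).
rewrite -(hw_F hw) mulmxA mulmxE KF1 -scalemxAl -mulmxE -mulmxA IH -scalemxAr scalerA.
congr (_ *: _); rewrite /str_wt [q ^+ j.+1]exprS; have := q_neq0.
have : q ^+ j != 0 by rewrite expf_neq0.
by move: (q ^+ j) => x x0 y0; field; rewrite x0 y0.
Qed.

Lemma string_Ki j : Ki *m v j = (str_wt j)^-1 *: v j.
Proof.
have : Ki *m (K *m v j) = v j by rewrite mulmxA mulmxE KiK mul1mx.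
rewrite string_K -scalemxAr => /(congr1 (fun w => (str_wt j)^-1 *: w)).
by rewrite scalerA mulVf ?scale1r// str_wt_neq0.
Qed.

Lemma str_coef0 : str_coef 0 = 0.
Proof. by rewrite /str_coef expr0 invr1 subrr !mul0r. Qed.

Lemma str_coefS j :
  str_coef j.+1 = str_coef j + (q - q^-1)^-1 * (str_wt j - (str_wt j)^-1).
Proof.
have d1 : q * q - 1 != 0.
  apply: contraNneq qbr_neq0 => h.
  by rewrite -(mulfK q_neq0 (q - q^-1)) mulrBl mulVf// h mul0r.
have x0 : q ^+ j != 0 by rewrite expf_neq0.
have := kap_neq0; rewrite /str_coef /str_wt !exprS expr0 mulr1.
move: (q ^+ j) x0 => x x0 k0.
by field; rewrite ?x0 ?q_neq0 ?d1 ?k0.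
Qed.

Lemma string_E j : E *m v j.+1 = str_coef j.+1 *: v j.
Proof.
have EF : E * F = F * E + (q - q^-1)^-1 *: (K - Ki) by rewrite -EF1 addrC subrK.
elim: j => [|j IH]; rewrite -(hw_F hw) mulmxA mulmxE EF mulmxDl -mulmxE -mulmxA.
  rewrite (hw_E0 hw) mulmx0 add0r -scalemxAl mulmxBl string_K string_Ki -scalerBl scalerA.
  by rewrite str_coefS str_coef0 add0r.
rewrite IH -scalemxAr (hw_F hw) -scalemxAl mulmxBl string_K string_Ki -scalerBl scalerA.
by rewrite -scalerDl -str_coefS.
Qed.

Lemma str_coef_end : str_coef n.+1 = 0.
Proof.
have := string_E n; rewrite (hw_end hw) mulmx0 => /esym/eqP.
by rewrite scaler_eq0 (negPf (string_neq0 (leqnn n))) orbF => /eqP.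
Qed.

Lemma string_EX j m : str_fact j *: (E ^+ m *m v (j + m)) = str_fact (j + m) *: v j.
Proof.
elim: m j => [|m IH] j; first by rewrite addn0 expr0 mul1mx.
rewrite exprSr -mulmxE -mulmxA addnS string_E -scalemxAr scalerA mulrC -scalerA IH.
by rewrite /str_fact big_ord_recr /= scalerA mulrC.
Qed.

Lemma str_coef_neq0 j : E *m v j.+1 != 0 -> str_coef j.+1 != 0.
Proof. by apply: contraNneq => h; rewrite string_E h scale0r. Qed.

Lemma str_fact_neq0 m :
  (forall j, (j < m)%N -> E *m v j.+1 != 0) -> str_fact m != 0.
Proof. by move=> h; apply/prodf_neq0 => t _; apply: str_coef_neq0; apply: h. Qed.

Hypothesis sb : string_basis.

(** Used to find how E, F and K act on the dual basis from the right: the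
    coordinates of a tensor acted on by a coproduct are computed by moving the
    operators to the rows u i. *)
Lemma string_mx_ext p (M M' : 'M[C]_(p, N)) :
  (forall j, (j <= n)%N -> M *m v j = M' *m v j) -> M = M'.
Proof.
move=> h; rewrite -[M]mulmx1 -[M']mulmx1 -(sb_sum sb) !mulmx_sumr.
by apply: eq_bigr => j _; rewrite !mulmxA h// -ltnS.
Qed.

Lemma costring_K i : (i <= n)%N -> u i *m K = str_wt i *: u i.
Proof.
move=> ni; apply: string_mx_ext => j nj; rewrite -mulmxA string_K -scalemxAr -scalemxAl sb_dual//.
by case: eqP => [->|_] //; rewrite scale_scalar_mx mulr0 scale_scalar_mx mulr0.
Qed.

Lemma costring_KX i s : (i <= n)%N -> u i *m K ^+ s = str_wt i ^+ s *: u i.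
Proof.
move=> ni; elim: s => [|s IH]; first by rewrite !expr0 mulmx1 scale1r.
by rewrite exprSr -mulmxE mulmxA IH -scalemxAl costring_K// scalerA -exprSr.
Qed.

Lemma costring_KiX i s : (i <= n)%N -> u i *m Ki ^+ s = str_wt i ^- s *: u i.
Proof.
move=> ni; have h : u i *m Ki = (str_wt i)^-1 *: u i.
  apply: string_mx_ext => j nj; rewrite -mulmxA string_Ki -scalemxAr -scalemxAl sb_dual//.
  by case: eqP => [->|_] //; rewrite scale_scalar_mx mulr0 scale_scalar_mx mulr0.
elim: s => [|s IH]; first by rewrite !expr0 mulmx1 invr1 scale1r.
by rewrite exprSr -mulmxE mulmxA IH -scalemxAl h scalerA -invfM -exprSr.
Qed.

Lemma costring_FX i s : (s <= i <= n)%N -> u i *m F ^+ s = u (i - s).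
Proof.
move=> /andP[si ni]; apply: string_mx_ext => j nj.
rewrite -mulmxA string_FX (sb_dual sb (leq_trans (leq_subr _ _) ni) nj).
case: (leqP (s + j) n) => sj.
  rewrite sb_dual//; congr (_ %:R %:M).
  by rewrite -(eqn_add2l s (i - s)) subnKC.
have -> : v (s + j) = 0.
  by rewrite -(subnK sj) -string_FX (hw_end hw) mulmx0.
rewrite mulmx0; case: eqP => [e|_]; last by apply/matrixP => ? ?; rewrite !mxE mul0rn.
by move: sj; rewrite -e subnKC// ltnNge ni.
Qed.

Lemma costring_E i : (i < n)%N -> u i *m E = str_coef i.+1 *: u i.+1.
Proof.
move=> ni; apply: string_mx_ext => -[|j] nj; rewrite -mulmxA -scalemxAl.
  by rewrite (hw_E0 hw) mulmx0 (sb_dual sb)// scale_scalar_mx mulr0 raddf0.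
rewrite string_E -scalemxAr !(sb_dual sb) ?(ltnW ni) ?(ltnW nj)//.
by rewrite eqSS; case: eqP => [->|_] //; rewrite !scale_scalar_mx !mulr0.
Qed.

Lemma costring_EX i m : (i + m <= n)%N ->
  str_fact i *: (u i *m E ^+ m) = str_fact (i + m) *: u (i + m).
Proof.
elim: m => [|m IH] im; first by rewrite addn0 expr0 mulmx1.
have im' : (i + m < n)%N by rewrite -addnS.
rewrite exprSr -mulmxE mulmxA scalemxAl IH ?(ltnW im')// -scalemxAl costring_E// scalerA.
by rewrite addnS /str_fact [in RHS]big_ord_recr.
Qed.

(** M maps v 0 to a vector killed by E, hence to a multiple of v 0; applying F
    carries the same scalar along the string. *)
Lemma string_schur (M : 'M[C]_N) : M *m E = E *m M -> M *m F = F *m M ->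
  exists c, M = c%:M.
Proof.
move=> ME MF.
have Mv0 : M *m v 0 = (u 0 *m M *m v 0) 0 0 *: v 0.
  have ex : M *m v 0 = \sum_(j < n.+1) (u j *m M *m v 0) 0 0 *: v j.
    rewrite -[LHS]mul1mx -(sb_sum sb) mulmx_suml; apply: eq_bigr => j _.
    by rewrite -!mulmxA {1}[u j *m _]mx11_scalar mul_mx_scalar.
  have : E *m (M *m v 0) = 0 by rewrite mulmxA -ME -mulmxA (hw_E0 hw) mulmx0.
  rewrite {1}ex big_ord_recl mulmxDr -scalemxAr (hw_E0 hw) scaler0 add0r => h.
  rewrite {1}ex big_ord_recl big1 ?addr0// => j _.
  have /(congr1 (mulmx (u j))) := h; rewrite mulmx0 !mulmx_sumr (bigD1 j)//= big1 ?addr0.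
    rewrite /bump /= add1n -!scalemxAr string_E -scalemxAr sb_dual ?(ltnW (ltn_ord j))// eqxx.
    rewrite scalerA => /matrixP/(_ 0 0); rewrite !mxE mulr1 => /eqP.
    by rewrite mulf_eq0 (negPf (str_coef_neq0 (sb_E sb _))) ?orbF// => /eqP ->; rewrite scale0r.
  move=> i ij; rewrite /bump /= add1n -!scalemxAr string_E -scalemxAr.
  rewrite sb_dual ?(ltnW (ltn_ord _))// eq_sym val_eqE (negPf ij).
  by rewrite !scale_scalar_mx !mulr0 raddf0.
exists ((u 0 *m M *m v 0) 0 0); apply: string_mx_ext => j _.
have MFX s : M *m F ^+ s = F ^+ s *m M.
  elim: s => [|s IH]; first by rewrite expr0 mulmx1 mul1mx.
  by rewrite exprS -mulmxE mulmxA MF -!mulmxA IH.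
rewrite -[j]addn0 -string_FX mulmxA MFX -mulmxA Mv0 -scalemxAr -mul_scalar_mx.
by [].
Qed.

Variable r : nat.
Local Notation Q := (q ^+ 2).
Hypotheses (r_gt0 : (0 < r)%N) (Fr : F ^+ r = 0).
Hypotheses (Q_r : Q ^+ r = 1) (Q_prim : forall i, (0 < i < r)%N -> Q ^+ i != 1).

Lemma string_length : (n < r)%N.
Proof.
rewrite ltnNge; apply/negP => rn; have := string_neq0 (leqnn n).
by rewrite -(subnK rn) addnC -[v _]string_FX Fr mul0mx eqxx.
Qed.

Lemma str_wtE j : str_wt j = kap / Q ^+ j.
Proof. by rewrite /str_wt exprAC. Qed.

Lemma str_wt_pred j : str_wt j ^+ r.-1 = kap ^+ r.-1 * Q ^+ j.
Proof.
rewrite str_wtE expr_div_n; congr (_ * _).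
have Qj : Q ^+ j != 0 by rewrite !expf_neq0.
apply: (mulIf (expf_neq0 r.-1 Qj)); rewrite mulVf ?expf_neq0// -exprS prednK//.
by rewrite [RHS](exprAC Q j r) Q_r expr1n.
Qed.

Lemma string_KX j m : K ^+ m *m v j = str_wt j ^+ m *: v j.
Proof.
elim: m => [|m IH]; first by rewrite !expr0 mul1mx scale1r.
by rewrite exprSr -mulmxE -mulmxA string_K -scalemxAr IH scalerA -exprS.
Qed.

Lemma sum_gbin_widen p p' (G : nat -> 'M[C]_(p, p')) j : (j <= n)%N ->
  \sum_(s < j.+1) gbin Q j s *: G s = \sum_(s < n.+1) gbin Q j s *: G s.
Proof.
move=> jn; rewrite (big_ord_widen n.+1 (fun s => gbin Q j s *: G s))//.
rewrite [RHS](bigID (fun s : 'I_n.+1 => (s < j.+1)%N)) /= [X in _ + X]big1 ?addr0//.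
by move=> s; rewrite -leqNgt => js; rewrite gbin_small// scale0r.
Qed.

Local Notation DE := (1%:M *t E + E *t K).
Local Notation DF := (F *t 1%:M + Ki *t F).

(** In the q-binomial expansion of DF^j, each term sends u j (x) u n to a
    multiple of a single u s (x) u (n - s). *)
Lemma DFX_row j : (j <= n)%N ->
  (u j *t u n) *m DF ^+ j =
  \sum_(s < n.+1) gbin Q j s *: (str_wt s ^- s *: (u s *t u (n - s))).
Proof.
move=> jn; rewrite (gbin_expansion _ (Q := Q)); last first.
  rewrite -!mulmxE !tensmx_mul !mul1mx !mulmx1 mulmxE (KiF1 q_neq0 KKi KiK KF1).
  by rewrite tensmxZl.
rewrite mulmx_sumr
  -(sum_gbin_widen (fun s => str_wt s ^- s *: (u s *t u (n - s))))//; apply: eq_bigr => s _.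
have sj : (s <= j)%N by rewrite -ltnS.
rewrite -scalemxAr !tensmxX -mulmxE tensmx_mul tensmx_mul expr1n mul1mx mulmxA.
rewrite costring_FX ?leq_subr// subKn// costring_FX ?(leq_trans sj)//=.
by rewrite costring_KiX ?tensmxZl// (leq_trans sj).
Qed.

(** The analogue for E, normalized by str_fact because E acts on the dual basis
    with the coefficients str_coef. *)
Lemma DEX_row j : (j <= n)%N ->
  str_fact j *: ((u 0 *t u j) *m DE ^+ (n - j)) =
  \sum_(s < n.+1) gbin Q (n - j) s *:
    ((str_fact s * str_fact (n - s) * str_wt (n - s) ^+ s) *: (u s *t u (n - s))).
Proof.
move=> jn; rewrite (gbin_expansion _ (Q := Q)); last first.
  by rewrite -!mulmxE !tensmx_mul !mul1mx !mulmx1 mulmxE KE1 tensmxZr.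
rewrite mulmx_sumr -(sum_gbin_widen (fun s => (str_fact s * str_fact (n - s) *
  str_wt (n - s) ^+ s) *: (u s *t u (n - s)))) ?leq_subr// scaler_sumr; apply: eq_bigr => s _.
have sj : (s <= n - j)%N by rewrite -ltnS.
have sn : (s <= n)%N by apply: leq_trans sj (leq_subr _ _).
rewrite -scalemxAr [LHS]scalerA [str_fact j * _]mulrC -[LHS]scalerA; congr (_ *: _).
rewrite !tensmxX -mulmxE !tensmx_mul expr1n mul1mx mulmxA.
have e : (j + (n - j - s) = n - s)%N by rewrite addnBA// subnKC.
rewrite -[LHS]tensmxZr scalemxAl costring_EX ?e ?leq_subr// -scalemxAl costring_KX ?leq_subr//.
have := @costring_EX 0 s sn; rewrite /str_fact big_ord0 scale1r add0n -/(str_fact s) => ->.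
by rewrite tensmxZl 2!tensmxZr !scalerA.
Qed.

Lemma str_fact_split s : (s <= n)%N ->
  (forall j, (j < n)%N -> str_coef j.+1 = str_coef (n - j)) ->
  str_fact s * str_fact (n - s) = str_fact n.
Proof.
move=> sn sym; rewrite -[in RHS](subnKC sn) /str_fact [RHS]big_split_ord /=.
congr (_ * _); rewrite (reindex_inj rev_ord_inj) /=; apply: eq_bigr => i _.
have ins : (s + i < n)%N by rewrite -[X in (_ < X)%N](subnKC sn) ltn_add2l.
by rewrite [RHS]sym// subnSK ?subnDA// ltn_subRL.
Qed.

(** The coefficient of E at n + 1 vanishes while [n + 1] does not, so kap is
    q^n or - q^n: up to sign, the weights are those of the simple sl_2-module of
    dimension n + 1. *)
Lemma short_string : (n.+1 < r)%N -> kap ^+ 2 = Q ^+ n.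
Proof.
move=> nr; have := str_coef_end; have x0 : q ^+ n.+1 != 0 by rewrite expf_neq0.
have Qn : Q ^+ n.+1 != 1 by rewrite Q_prim.
rewrite /str_coef => /eqP; rewrite !mulf_eq0 invr_eq0 expf_eq0 (negPf qbr_neq0) andbF orbF.
have k0 := kap_neq0; case/orP => /eqP h.
  case/negP: Qn; rewrite exprAC -subr_eq0; apply/eqP.
  have -> : q ^+ n.+1 ^+ 2 - 1 = q ^+ n.+1 * (q ^+ n.+1 - q ^- n.+1).
    by rewrite mulrBr divff// expr2.
  by rewrite h mulr0.
have : (kap * q) * (q ^+ n.+1) * (kap * q / q ^+ n.+1 - q ^+ n.+1 / (kap * q)) = 0.
  by rewrite h mulr0.
have -> : (kap * q) * (q ^+ n.+1) * (kap * q / q ^+ n.+1 - q ^+ n.+1 / (kap * q)) =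
    (kap ^+ 2 - (q ^+ n) ^+ 2) * q ^+ 2.
  rewrite exprS; have : q ^+ n != 0 by rewrite expf_neq0.
  have := q_neq0; move: (q ^+ n) => x y0 z0.
  by field; rewrite y0 z0 k0.
move/eqP; rewrite mulf_eq0 (negPf (expf_neq0 _ q_neq0)) orbF subr_eq0 => /eqP ->.
by rewrite exprAC.
Qed.

Lemma short_string_sym j : (n.+1 < r)%N -> (j < n)%N -> str_coef j.+1 = str_coef (n - j).
Proof.
move=> nr jn; have := short_string nr; rewrite exprAC => k2.
have k0 := kap_neq0; have w0 : kap * q != 0 by rewrite mulf_neq0.
have half x y : x != 0 -> (kap * q) ^+ 2 = (x * y) ^+ 2 ->
    (x - x^-1) * (kap * q / x - x / (kap * q)) = (x ^+ 2 - 1) * (y ^+ 2 - 1) / (kap * q).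
  move: (kap * q) w0 => w w0 x0 w2.
  have -> : w / x = x * y ^+ 2 / w.
    by apply/eqP; rewrite eqr_div// -expr2 w2; apply/eqP; ring.
  by field; rewrite x0 w0.
have e : (kap * q) ^+ 2 = (q ^+ j.+1 * q ^+ (n - j)) ^+ 2.
  by rewrite exprMn k2 -exprMn -exprSr -exprD addSn subnKC// ltnW.
rewrite /str_coef (half _ (q ^+ (n - j)))// ?expf_neq0// (half _ (q ^+ j.+1)) ?expf_neq0//.
  by rewrite [(_ - 1) * _]mulrC.
by rewrite e [X in X ^+ 2]mulrC.
Qed.

(** For n + 1 = r only s = n survives, and its two factors agree by Q^r = 1.
    For n + 1 < r, kap^2 = Q^n and the symmetry of the coefficients of E make
    the factors after the Gaussian binomial equal. *)
Lemma string_coef_agree s : (s <= n)%N ->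
  gbin Q n.+1 s.+1 * (kap ^+ r.-1 * str_wt s ^- s) * str_fact n =
  gbin Q n.+1 s.+1 * (kap ^- r.-1 / Q ^+ n *
     (str_fact s * str_fact (n - s) * str_wt (n - s) ^+ s)).
Proof.
move=> sn; have k0 := kap_neq0; have Q0 i : Q ^+ i != 0 by rewrite !expf_neq0.
have := string_length; rewrite leq_eqVlt => /predU1P[nr|nr].
  move: sn; rewrite leq_eqVlt => /predU1P[->|sn]; last first.
    by rewrite nr (gbin_root Q_r Q_prim) ?mul0r// /= -nr ltnS.
  rewrite -nr /= subnn /str_fact big_ord0 mulr1 -/(str_fact n) -!mulrA; congr (_ * _).
  rewrite !str_wtE expr0 divr1 expr_div_n invf_div.
  have e : (Q ^+ n) ^+ n = (Q ^+ n)^-1.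
    by apply: (mulIf (Q0 n)); rewrite mulVf// -exprSr nr [LHS](exprAC Q n r) Q_r expr1n.
  rewrite e; have := expf_neq0 n k0; move: (kap ^+ n) (Q0 n) => x; move: (Q ^+ n) => y y0 x0.
  by field; rewrite x0 y0.
rewrite (str_fact_split sn) => [|j jn]; last exact: short_string_sym.
rewrite -!mulrA; congr (_ * _); rewrite !mulrA mulrAC -!mulrA [LHS]mulrCA [RHS]mulrA [RHS]mulrCA.
congr (_ * _); rewrite !str_wtE !expr_div_n invf_div.
have Y2 : (kap ^+ s) ^+ 2 = (Q ^+ s) ^+ s * (Q ^+ (n - s)) ^+ s.
  by rewrite exprAC (short_string nr) -exprMn -exprD subnKC.
have X2 : (kap ^+ r.-1) ^+ 2 * Q ^+ n = 1.
  by rewrite exprAC (short_string nr) -exprSr prednK// [LHS](exprAC Q n r) Q_r expr1n.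
have X0 := expf_neq0 r.-1 k0; have Y0 := expf_neq0 s k0.
have B0 := expf_neq0 s (Q0 (n - s)%N).
have -> : kap ^- r.-1 / Q ^+ n = kap ^+ r.-1.
  move: X2 X0 (Q0 n); move: (kap ^+ r.-1) (Q ^+ n) => X Z X2 X0 Z0.
  apply: (mulIf Z0); rewrite mulfVK//; apply: (mulIf X0); rewrite mulVf// -X2.
  by ring.
by congr (_ * _); apply/eqP; rewrite eqr_div// -Y2 expr2.
Qed.

Section Traces.
Variable f : 'M[C]_(N * N).
Hypotheses (fE : f *m DE = DE *m f) (fF : f *m DF = DF *m f).

Let a s : 'M[C]_1 := (u s *t u (n - s)) *m f *m (v 0 *t v n).

Lemma commX (A : 'M[C]_(N * N)) s : f *m A = A *m f -> f *m A ^+ s = A ^+ s *m f.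
Proof.
move=> h; elim: s => [|s IH]; first by rewrite expr0 mulmx1 mul1mx.
by rewrite exprS -mulmxE mulmxA h -!mulmxA IH.
Qed.

(** The left partial trace of f at v n, in the coordinates of f (v 0 (x) v n):
    v j (x) v n is DF^j (v 0 (x) v n) since F kills v n, and f commutes with DF. *)
Lemma left_trace :
  \sum_(j < n.+1) (u j *t u n) *m f *m ((K ^+ r.-1 *m v j) *t v n) =
  \sum_(s < n.+1) (gbin Q n.+1 s.+1 * Q ^+ s * (kap ^+ r.-1 * str_wt s ^- s)) *: a s.
Proof.
have step j : (j < n.+1)%N -> (u j *t u n) *m f *m ((K ^+ r.-1 *m v j) *t v n) =
    \sum_(s < n.+1) (Q ^+ j * gbin Q j s * (kap ^+ r.-1 * str_wt s ^- s)) *: a s.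
  rewrite ltnS => jn; rewrite string_KX tensmxZl -scalemxAr.
  have -> : v j *t v n = DF ^+ j *m (v 0 *t v n).
    elim: j {jn} => [|j IH]; first by rewrite expr0 mul1mx.
    rewrite exprS -mulmxE -mulmxA -IH mulmxDl !tensmx_mul mul1mx !(hw_F hw) (hw_end hw).
    by rewrite tensmx0 addr0.
  rewrite -mulmxA (mulmxA f) (commX j fF) !mulmxA DFX_row// !mulmx_suml scaler_sumr.
  apply: eq_bigr => s _; rewrite -!scalemxAl !scalerA str_wt_pred; congr (_ *: _).
  by ring.
rewrite (eq_bigr _ (fun (j : 'I_n.+1) _ => step j (ltn_ord j))) exchange_big.
apply: eq_bigr => s _ /=.
by rewrite -scaler_suml -mulr_suml sum_gbin [Q ^+ s * _]mulrC.
Qed.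

(** The right partial trace of f at v 0: v 0 (x) v j is a multiple of
    DE^(n-j) (v 0 (x) v n) since E kills v 0.  The scaling by str_fact n clears
    the denominators of that multiple. *)
Lemma right_trace :
  str_fact n *: \sum_(j < n.+1) (u 0 *t (u j *m Ki ^+ r.-1)) *m f *m (v 0 *t v j) =
  \sum_(s < n.+1) (gbin Q n.+1 s.+1 * Q ^+ s * (kap ^- r.-1 / Q ^+ n *
     (str_fact s * str_fact (n - s) * str_wt (n - s) ^+ s))) *: a s.
Proof.
have step j : (j < n.+1)%N ->
    str_fact n *: ((u 0 *t (u j *m Ki ^+ r.-1)) *m f *m (v 0 *t v j)) =
    \sum_(s < n.+1) (Q ^+ (n - j) * gbin Q (n - j) s * (kap ^- r.-1 / Q ^+ n *
     (str_fact s * str_fact (n - s) * str_wt (n - s) ^+ s))) *: a s.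
  rewrite ltnS => jn; rewrite costring_KiX// tensmxZr -!scalemxAl scalerA mulrC -scalerA.
  rewrite scalemxAr -tensmxZr.
  have <- : str_fact j *: (E ^+ (n - j) *m v n) = str_fact n *: v j.
    by have := string_EX j (n - j); rewrite subnKC.
  have -> : v 0 *t (str_fact j *: (E ^+ (n - j) *m v n)) =
      str_fact j *: (DE ^+ (n - j) *m (v 0 *t v n)).
    rewrite tensmxZr; congr (_ *: _); elim: (n - j)%N => [|m IH].
      by rewrite !expr0 !mul1mx.
    rewrite !exprS -!mulmxE -!mulmxA -IH mulmxDl !tensmx_mul mul1mx (hw_E0 hw).
    by rewrite tens0mx addr0.
  rewrite -scalemxAr -mulmxA (mulmxA f) (commX _ fE) !mulmxA 2!scalemxAl DEX_row//.
  rewrite !mulmx_suml scaler_sumr; apply: eq_bigr => s _.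
  rewrite -!scalemxAl !scalerA str_wt_pred; congr (_ *: _).
  have -> : (kap ^+ r.-1 * Q ^+ j)^-1 = kap ^- r.-1 / Q ^+ n * Q ^+ (n - j).
    rewrite -[in RHS](subnKC jn) addKn exprD !invfM mulrA mulfVK//.
    by rewrite expf_neq0// expf_neq0.
  by ring.
rewrite scaler_sumr (eq_bigr _ (fun (j : 'I_n.+1) _ => step j (ltn_ord j))) exchange_big.
apply: eq_bigr => s _ /=; rewrite -scaler_suml -mulr_suml; congr (_ * _ *: _).
rewrite (reindex_inj rev_ord_inj) /= [RHS]mulrC -sum_gbin; apply: eq_bigr => j _.
by rewrite !subSS subKn// -ltnS.
Qed.

Lemma traces_agree :
  \sum_(j < n.+1) (u j *t u n) *m f *m ((K ^+ r.-1 *m v j) *t v n) =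
  \sum_(j < n.+1) (u 0 *t (u j *m Ki ^+ r.-1)) *m f *m (v 0 *t v j).
Proof.
apply: (scalerI (str_fact_neq0 (sb_E sb))); rewrite right_trace left_trace scaler_sumr.
apply: eq_bigr => s _; rewrite scalerA; congr (_ *: _).
have := string_coef_agree (leq_ord s).
move: (gbin _ _ _) (Q ^+ s) (kap ^+ _ * _) (str_fact n) (_ / _ * _) => g x y z t h.
by transitivity (x * (g * y * z)); [ring | rewrite h; ring].
Qed.

End Traces.

End String.

(** * Modules with a string basis are ambidextrous *)

Section Ambidextrous.
Variables (R : realType) (r : nat).
Hypothesis r_ge2 : (2 <= r)%N.
Local Notation C := R[i].
Local Notation q := (qroot R r).

Let r_gt0 : (0 < r)%N. Proof. exact: ltnW. Qed.

Lemma q2_prim i : (0 < i < r)%N -> (q ^+ 2) ^+ i != 1.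
Proof.
move=> ir; have := qbr_nat_neq0 R ir; rewrite qbr_nat; apply: contraNneq => q2i.
have x0 : q ^+ i != 0 by rewrite expf_neq0// q_neq0.
move: q2i; rewrite exprAC => q2i.
by apply/eqP; apply: (mulfI x0); rewrite mulr0 mulrBr divff// -expr2 q2i subrr.
Qed.

(** Both partial traces are scalars by string_schur; evaluating the left one at
    v n and the right one at v 0 brings them into the form of traces_agree. *)
Lemma string_ambidextrous (V : wmod R r) n kap v u :
  hw_string n kap (uE V) (uF V) (uK V) v -> string_basis n (uE V) v u -> ambidextrous V.
Proof.
move=> hw sb T; have hV := wmodP V; have hT := Ulin_RT r_ge2 T.
set f : 'M[C]_(udim V * udim V) := RT T in hT *.
have q0 := q_neq0 R r; have qb := qbr1q R r_ge2.
have schur := string_schur hw q0 qb (urel_KiK hV) (urel_KF hV) (urel_EF hV) sb.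
have [hE hF _ _] := hT.
have [LE LF _ _] := Ulin_ptrL r_ge2 (V := V) (W := V) hT.
have [RE RF _ _] := Ulin_ptrR r_ge2 (V := V) (W := V) hT.
have [cL EL] := schur _ LE LF; have [cR ER] := schur _ RE RF.
have tr := traces_agree hw q0 qb (urel_KKi hV) (urel_KiK hV) (urel_KE hV) (urel_KF hV)
  (urel_EF hV) sb r_gt0 (urel_Fr hV) (q2_r R r_gt0) q2_prim hE hF.
have vu := sb_sum sb.
have := ptrL_pairing r f (u n) (v n) vu; have := ptrR_pairing r f (u 0) (v 0) vu.
rewrite -tr => <-; rewrite EL ER !mul_mx_scalar -!scalemxAl !(sb_dual sb)//.
by move=> /matrixP/(_ 0 0); rewrite !mxE !eqxx !mulr1 => ->.
Qed.

Lemma verma_string (a : C) : (forall i, (0 < i < r)%N -> qbr r (i%:R - a) != 0) ->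
  exists n kap v u,
    hw_string n kap (uE (verma_U r a)) (uF (verma_U r a)) (uK (verma_U r a)) v /\
    string_basis n (uE (verma_U r a)) v u.
Proof.
move=> typ; pose v j : 'cV[C]_r := \col_i (i == j :> nat)%:R.
pose u j : 'rV[C]_r := \row_i (i == j :> nat)%:R.
have sumv (F : nat -> C) j : (j < r)%N -> \sum_(i < r) F i * (i == j :> nat)%:R = F j.
  by move=> jr; rewrite -(sum_delta (fun i : 'I_r => F i) (Ordinal jr)).
have Ev (j : nat) (jr : (j < r)%N) i : (uE (verma_U r a) *m v j) i 0 =
    if j == i.+1 then verma_coef r a j else 0.
  rewrite mxE -(sumv (fun j => if j == i.+1 then verma_coef r a j else 0))//.
  by apply: eq_bigr => k _; rewrite !mxE.
exists r.-1, (qpow r (verma_wt r a 0)), v, u; split; split.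
- move=> j; apply/colP => i; rewrite !mxE; case: (ltnP j r) => jr.
    rewrite -(sumv (fun j => (i == j.+1 :> nat)%:R))//; apply: eq_bigr => k _.
    by rewrite !mxE.
  rewrite big1 => [|k _]; last by rewrite !mxE [k == j :> nat]ltn_eqF ?mulr0// (leq_trans _ jr).
  by rewrite ltn_eqF// (leq_trans (ltn_ord i)) ?leqW.
- by apply/colP => i; rewrite !mxE prednK// ltn_eqF.
- have rr : (r.-1 < r)%N by rewrite prednK.
  apply/eqP => /colP/(_ (Ordinal rr)).
  by rewrite !mxE eqxx => /eqP; rewrite oner_eq0.
- by apply/colP => i; rewrite Ev// mxE.
- apply/colP => i; rewrite mul_diag_mx !mxE.
  by case: eqP => [->|_]; rewrite ?mulr0.
- move=> j jr; have jr1 : (j.+1 < r)%N by rewrite -[r]prednK// ltnS.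
  apply/eqP => /colP/(_ (Ordinal (ltnW jr1))); rewrite Ev// mxE eqxx => /eqP.
  by rewrite !mulf_eq0 invr_eq0 expf_eq0 (negPf (qbr_nat_neq0 R _))// (negPf (typ _ _))//
    (negPf (qbr1_neq0 R r_ge2)).
- move=> i j ir jr; have lt_r k : (k <= r.-1)%N -> (k < r)%N by move=> h; rewrite -[r]prednK.
  apply/matrixP => x y; rewrite !(ord1 x) !(ord1 y) !mxE mulr1n eq_sym.
  rewrite -(sumv (fun k => (k == i)%:R) j) ?lt_r//.
  by apply: eq_bigr => k _; rewrite !mxE.
- rewrite prednK//; apply/matrixP => i j; rewrite summxE !mxE.
  rewrite -(sum_delta (fun k : 'I_r => (i == k)%:R) j); apply: eq_bigr => k _.
  by rewrite mxE big_ord1 !mxE [j == k :> nat]eq_sym.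
Qed.

End Ambidextrous.

(** * Simple modules have a string basis *)

Section Simple.
Variables (R : realType) (r : nat) (V : wmod R r).
Hypotheses (r_ge2 : (2 <= r)%N) (simpleV : simple_module V).
Local Notation C := R[i].
Local Notation q := (qroot R r).
Local Notation E := (uE V).
Local Notation F := (uF V).
Local Notation K := (uK V).
Local Notation Ki := (uKi V).
Local Notation H := (uH V).
Local Notation N := (udim V).

Let hV := wmodP V.

Lemma nilpotent_last (A : 'M[C]_N) (w : 'cV[C]_N) : A ^+ r = 0 -> w != 0 ->
  exists m, A ^+ m *m w != 0 /\ A ^+ m.+1 *m w = 0.
Proof.
move=> Ar w0; have ex : exists m, A ^+ m *m w == 0 by exists r; rewrite Ar mul0mx.
case: (ex_minnP ex) => -[|m] /eqP mw mmin.
  by move: mw w0; rewrite expr0 mul1mx => ->; rewrite eqxx.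
by exists m; split=> //; apply/negP => /mmin; rewrite ltnn.
Qed.

Lemma weight_shiftX (A : 'M[C]_N) a l (w : 'cV[C]_N) m : shifts A a ->
  H *m w = l *: w -> exists l', H *m (A ^+ m *m w) = l' *: (A ^+ m *m w).
Proof.
move=> hA hw; elim: m => [|m [l' IH]]; first by exists l; rewrite expr0 mul1mx.
by exists (l' + a); rewrite exprS -mulmxE -mulmxA; apply: hA.
Qed.

(** Apply E to a weight vector until the next step gives zero, then F. *)
Lemma simple_hw_string : exists n kap v, hw_string n kap E F K v /\
  (forall j, exists l, H *m v j = l *: v j).
Proof.
have [N0 _] := simpleV.
have [B Bu [d Bd]] := weight_basis V.
pose w := col (Ordinal N0) B.
have w0 : w != 0.
  apply/eqP => h; have : invmx B *m w = 0 by rewrite h mulmx0.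
  rewrite /w colE mulmxA mulVmx// mul1mx => /matrixP/(_ (Ordinal N0) 0).
  by rewrite !mxE !eqxx => /eqP; rewrite oner_eq0.
have Hw : H *m w = d 0 (Ordinal N0) *: w := eigen_col _ Bd.
have [m [v0 Ev0]] := nilpotent_last (urel_Er hV) w0.
have [l Hv0] := weight_shiftX m (@shiftsE _ _ V) Hw.
have [n [vn vn1]] := nilpotent_last (urel_Fr hV) v0.
exists n, (qpow r l), (fun j => F ^+ j *m (E ^+ m *m w)); split; last first.
  by move=> j; apply: weight_shiftX (@shiftsF _ _ V) Hv0.
split=> //.
- by move=> j; rewrite exprS -mulmxE -mulmxA.
- by rewrite expr0 mul1mx mulmxA mulmxE -exprS.
- by rewrite expr0 mul1mx; exact: wtK.
Qed.

Section Strings.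
Variables (n : nat) (kap : C) (v : nat -> 'cV[C]_N).
Hypotheses (hw : hw_string n kap E F K v).
Hypotheses (Hv : forall j, exists l, H *m v j = l *: v j).

Let EE := string_E hw (q_neq0 R r) (qbr1q R r_ge2) (urel_KiK hV) (urel_KF hV) (urel_EF hV).

Let EX := string_EX hw (q_neq0 R r) (qbr1q R r_ge2) (urel_KiK hV) (urel_KF hV) (urel_EF hV).
Let fact_neq0 :=
  str_fact_neq0 hw (q_neq0 R r) (qbr1q R r_ge2) (urel_KiK hV) (urel_KF hV) (urel_EF hV).

Lemma tail_sub k (W : {vspace 'cV[C]_N}) :
  (forall j, (k <= j <= n)%N -> v j \in W) ->
  (<<[seq v j | j <- iota k (n.+1 - k)]>> <= W)%VS.
Proof.
move=> h; set X := [seq _ | _ <- _].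
apply/span_subvP => x /mapP[j]; rewrite mem_iota => /andP[kj jn] ->; apply: h.
rewrite kj -ltnS; case: (leqP k n.+1) jn => [kn|nk]; first by rewrite subnKC.
by rewrite (eqP (ltnW nk)) addn0 ltnNge kj.
Qed.

(** When E kills v k, the span of v k, ..., v n is a submodule; it contains
    v n, so it is not zero. *)
Lemma tail_full k : (k <= n)%N -> E *m v k = 0 ->
  <<[seq v j | j <- iota k (n.+1 - k)]>>%VS = fullv.
Proof.
move=> kn Ek; set X := [seq _ | _ <- _].
have vX j : (k <= j)%N -> v j \in <<X>>%VS.
  case: (leqP j n) => [jn kj|nj _].
    by apply: memv_span; apply: map_f; rewrite mem_iota kj subnKC// leqW.
  by rewrite -(subnK nj) -(string_FX hw) (hw_end hw) mulmx0 mem0v.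
have stab (A : 'M[C]_N) : (forall j, (k <= j)%N -> A *m v j \in <<X>>%VS) ->
    forall w, w \in <<X>>%VS -> A *m w \in <<X>>%VS.
  move=> h w wX.
  have /subvP/(_ w wX) : (<<X>> <= linfun (mulmx A : 'cV[C]_N -> 'cV[C]_N) @^-1: <<X>>)%VS.
    by apply: tail_sub => j /andP[kj _]; rewrite -memv_preim lfunE h.
  by rewrite -memv_preim lfunE.
have [_ /(_ <<X>>%VS) h] := simpleV.
case: h => // [w wX|X0]; last first.
  by have := vX n kn; rewrite X0 memv0 (negPf (hw_last hw)).
split; apply: stab (wX) => j kj.
- by have [l ->] := Hv j; rewrite memvZ// vX.
- move: kj; rewrite leq_eqVlt => /predU1P[<-|kj]; first by rewrite Ek mem0v.
  by case: j kj => // j kj; rewrite EE memvZ// vX.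
- by rewrite (hw_F hw) vX// leqW.
- by rewrite (string_K hw (q_neq0 R r) (urel_KF hV)) memvZ// vX.
- by rewrite (string_Ki hw (q_neq0 R r) (urel_KiK hV) (urel_KF hV)) memvZ// vX.
Qed.

(** If E killed v (j + 1), the vectors from v (j + 1) on would span the module.
    They lie in the image of F, which would be surjective and nilpotent. *)
Lemma simple_E_neq0 j : (j < n)%N -> E *m v j.+1 != 0.
Proof.
move=> jn; apply/eqP => Ej; have full := tail_full jn Ej.
have imF (w : 'cV[C]_N) : exists w', w = F *m w'.
  have : w \in (linfun (mulmx F : 'cV[C]_N -> 'cV[C]_N) @: fullv)%VS.
    suff /subvP : (fullv <= linfun (mulmx F : 'cV[C]_N -> 'cV[C]_N) @: fullv)%VS.
      by apply; rewrite memvf.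
    rewrite -[X in (X <= _)%VS]full; apply: tail_sub => -[|i] // _.
    by apply/memv_imgP; exists (v i); rewrite ?memvf// lfunE /= (hw_F hw).
  by case/memv_imgP => w' _ ->; exists w'; rewrite lfunE.
have imFX m (w : 'cV[C]_N) : exists w', w = F ^+ m *m w'.
  elim: m => [|m [w' ->]]; first by exists w; rewrite expr0 mul1mx.
  by have [w'' ->] := imF w'; exists w''; rewrite mulmxA mulmxE -exprSr.
have [w vE] := imFX r (v n).
by have := hw_last hw; rewrite vE (urel_Fr hV) mul0mx eqxx.
Qed.

Lemma simple_string_basis : exists u, string_basis n E v u.
Proof.
have full := tail_full (leq0n n) (hw_E0 hw).
pose B : 'M[C]_(N, n.+1) := \matrix_(i, j) v j i 0.
have Bx (x : 'cV_n.+1) : B *m x = \sum_(j < n.+1) x j 0 *: v j.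
  apply/colP => i; rewrite mxE summxE; apply: eq_bigr => j _.
  by rewrite !mxE mulrC.
have surj (w : 'cV[C]_N) : exists x, w = B *m x.
  have : w \in (linfun (mulmx B : 'cV[C]_n.+1 -> 'cV[C]_N) @: fullv)%VS.
    suff /subvP : (fullv <= linfun (mulmx B : 'cV[C]_n.+1 -> 'cV[C]_N) @: fullv)%VS.
      by apply; rewrite memvf.
    rewrite -[X in (X <= _)%VS]full; apply: tail_sub => j /andP[_]; rewrite -ltnS => jn.
    apply/memv_imgP; exists (delta_mx (Ordinal jn) 0); rewrite ?memvf// lfunE /= -colE.
    by apply/colP => i; rewrite !mxE.
  by case/memv_imgP => x _ ->; exists x; rewrite lfunE.
have [D BD] : exists D, B *m D = 1%:M.
  have [g gE] := choice (fun i : 'I_N => surj (delta_mx i 0)).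
  exists (\matrix_(k, i) g i k 0); apply/matrixP => a b.
  have /colP/(_ a) := gE b; rewrite !mxE eqxx andbT => ->.
  by apply: eq_bigr => k _; rewrite !mxE.
(* E ^+ t isolates the last nonzero coefficient, at index t, of a relation. *)
have inj (x : 'cV_n.+1) : B *m x = 0 -> x = 0.
  rewrite Bx => Bx0; apply/colP => i; rewrite mxE; apply/eqP/negPn/negP => xi.
  case: (@arg_maxnP _ i (fun j => x j 0 != 0) val xi) => t xt tmax.
  have : E ^+ t *m (\sum_(j < n.+1) x j 0 *: v j) = 0 by rewrite Bx0 mulmx0.
  rewrite mulmx_sumr (bigD1 t)//= big1 => [|j jt]; last first.
    have [->|xj] := eqVneq (x j 0) 0; first by rewrite scale0r mulmx0.
    have {}jt : (j < t)%N by rewrite ltn_neqAle jt; exact: tmax.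
    have := EX 0 j; rewrite /str_fact big_ord0 scale1r add0n => h.
    rewrite -scalemxAr -(subnK jt) exprD exprS -!mulmxE -!mulmxA h.
    by rewrite -!scalemxAr (hw_E0 hw) mulmx0 !scaler0.
  have := EX 0 t; rewrite {1}/str_fact big_ord0 scale1r add0n -scalemxAr => ->.
  rewrite addr0 scalerA => /eqP; rewrite scaler_eq0 (negPf (string_neq0 hw (leq0n n))) orbF.
  rewrite mulf_eq0 (negPf xt) /=; apply/negP; apply: fact_neq0 => j jt.
  by apply: simple_E_neq0; apply: leq_trans jt _; rewrite -ltnS.
have DB : D *m B = 1%:M.
  apply/eqP; rewrite -subr_eq0; apply/eqP/matrixP => a b.
  have := inj (col b (D *m B - 1%:M)).
  rewrite colE mulmxA mulmxBr mulmxA BD mul1mx mulmx1 subrr mul0mx => /(_ erefl).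
  by move=> /colP/(_ a); rewrite -colE !mxE.
exists (fun j => row (inord j) D); split.
- exact: simple_E_neq0.
- move=> i j ni nj; have /matrixP/(_ (inord i) (inord j)) := DB.
  rewrite !mxE -val_eqE /= !inordK// => h; apply/matrixP => a b.
  rewrite !ord1 !mxE mulr1n -[RHS]h; apply: eq_bigr => k _.
  by rewrite !mxE inordK.
- rewrite -BD; apply/matrixP => a b; rewrite summxE mxE; apply: eq_bigr => k _.
  by rewrite inord_val mxE big_ord1 !mxE.
Qed.

End Strings.
End Simple.

(** * The typical Verma modules *)

Section Typical.
Variables (R : realType) (r : nat).
Hypothesis r_ge2 : (2 <= r)%N.

(** If i - alpha were a multiple of r, then alpha would be an integer, and in the
    second case i itself would be a multiple of r. *)
Lemma typical_qbr_neq0 (alpha : R[i]) :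
  ~ (exists m : int, alpha = m%:~R) \/ (exists m : int, alpha = r%:R * m%:~R) ->
  forall i, (0 < i < r)%N -> qbr r (i%:R - alpha) != 0.
Proof.
have r_gt0 : (0 < r)%N by exact: ltnW.
move=> typ i ir; apply/eqP => /(qbr_eq0 r_gt0)[m mE].
case: typ => [|[k kE]].
  case; exists (i%:Z - r%:Z * m); rewrite rmorphB rmorphM /= -mE.
  by rewrite opprB addrC subrK.
apply: (@nat_lt_multiple R r i (m + k) ir).
by rewrite rmorphD mulrDr -mE -kE subrK.
Qed.

End Typical.

Theorem corollary3p11 (R : realType) (r : nat) (hr : (2 <= r)%N) :
  (forall alpha : R[i],
     ~ (exists m : int, alpha = m%:~R) \/
     (exists m : int, alpha = r%:R * m%:~R) ->
     ambidextrous (verma alpha hr)) /\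
  (forall V : wmod R r, simple_module V -> ambidextrous V).
Proof.
split=> [alpha typ | V simpleV].
  have [n [kap [v [u [hw sb]]]]] := verma_string hr (typical_qbr_neq0 hr typ).
  exact: (string_ambidextrous hr (V := verma alpha hr) hw sb).
have [n [kap [v [hw Hv]]]] := simple_hw_string simpleV.
have [u sb] := simple_string_basis hr simpleV hw Hv.
exact: (string_ambidextrous hr (V := V) hw sb).
Qed.
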